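(* Let $\mathcal{M}_1 = (U, \mathcal{I}_1)$ and $\mathcal{M}_2 = (U, \mathcal{I}_2)$ be two matroids on a common ground set $U$ with $n$ elements, and let $w: U \to \mathbb{R}$ be an unknown weight function. There is an algorithm that outputs a minimum-weight set in $\mathcal{I}_1 \cap \mathcal{I}_2$ using $O(n^4)$ comparison queries in $O(n^4)$ time.
   Context: $w(S) = \sum_{e \in S} w_e$. A comparison query takes two common independent sets $S, T \in \mathcal{I}_1 \cap \mathcal{I}_2$ and reveals whether $w(S) <, =, >$ $w(T)$. *)

(* Defs.v *)
From HB Require Import structures.
From mathcomp Require Import all_boot all_order all_algebra.
From mathcomp Require Import reals.

Set Implicit Arguments.
Unset Strict Implicit.
Unset Printing Implicit Defensive.

Import Order.TTheory GRing.Theory Num.Theory.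

Record matroid (U : finType) := Matroid {
  indep :> pred {set U};
  indep_set0 : indep set0;
  indep_sub : forall A B : {set U}, A \subset B -> indep B -> indep A;
  indep_aug : forall A B : {set U}, indep A -> indep B -> #|A| < #|B| ->
    exists2 x, x \in B :\: A & indep (x |: A) }.

Definition common (U : finType) (M1 M2 : matroid U) (S : {set U}) : bool :=
  M1 S && M2 S.

Definition weight (R : realType) (U : finType) (w : U -> R) (S : {set U}) : R :=
  (\sum_(e in S) w e)%R.

Definition min_weight_common (R : realType) (U : finType) (M1 M2 : matroid U)
    (w : U -> R) (S : {set U}) : Prop :=
  common M1 M2 S /\
  forall T : {set U}, common M1 M2 T -> (weight w S <= weight w T)%R.

(* Algorithms are programs of a word RAM with oracles. A program is a fixed   *)
(* finite piece of syntax: it depends neither on n nor on the instance.       *)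
(* Scalar variables and arrays are named by naturals.                         *)
Inductive expr :=
| Const of nat
| Var of nat
| Get of nat & expr (* Get a i: entry i of array a *)
| Add of expr & expr
| Sub of expr & expr (* truncated *)
| Mul of expr & expr
| Leq of expr & expr
| Eq of expr & expr.

(* Oracle calls take their sets as length-n segments of arrays: (a, i) stands *)
(* for the entries i, ..., i + n - 1 of array a.                              *)
Inductive cmd :=
| Skip
| Assign of nat & expr
| Put of nat & expr & expr (* Put a i e: a[i] := e *)
| Seq of cmd & cmd
| If of expr & cmd & cmd
| While of expr & cmd
| Indep1 of nat & nat & expr (* Indep1 x a i: x := ((a, i) in I_1) *)
| Indep2 of nat & nat & expr
| Compare of nat & nat & expr & nat & expr. (* x := compare (a, i) (b, j) *)

Record store := Store { vars : nat -> nat; arrs : nat -> nat -> nat }.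

Definition set_var (s : store) (x v : nat) : store :=
  Store (fun y => if y == x then v else vars s y) (arrs s).

Definition set_arr (s : store) (a i v : nat) : store :=
  Store (vars s)
        (fun b j => if (b == a) && (j == i) then v else arrs s b j).

Fixpoint eval (s : store) (e : expr) : nat :=
  match e with
  | Const k => k
  | Var x => vars s x
  | Get a i => arrs s a (eval s i)
  | Add e1 e2 => eval s e1 + eval s e2
  | Sub e1 e2 => eval s e1 - eval s e2
  | Mul e1 e2 => eval s e1 * eval s e2
  | Leq e1 e2 => eval s e1 <= eval s e2
  | Eq e1 e2 => eval s e1 == eval s e2
  end.

(* Number of elementary operations performed to evaluate an expression.       *)
Fixpoint esize (e : expr) : nat :=
  match e with
  | Const _ | Var _ => 1
  | Get _ i => (esize i).+1
  | Add e1 e2 | Sub e1 e2 | Mul e1 e2 | Leq e1 e2 | Eq e1 e2 =>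
      (esize e1 + esize e2).+1
  end.

(* The algorithm only sees the ground set as the indices 0, ..., n - 1.       *)
Definition set_at (U : finType) (s : store) (a i : nat) : {set U} :=
  [set u : U | arrs s a (i + enum_rank u) != 0].

Definition compare_weights (R : realType) (U : finType) (w : U -> R)
    (S T : {set U}) : nat :=
  if (weight w S < weight w T)%R then 0
  else if weight w S == weight w T then 1 else 2.

(* exec M1 M2 w W p s q t s': started in s, the program p halts in s' after   *)
(* q comparison queries and t time units. Every elementary operation, every   *)
(* independence test and every comparison query takes one time unit. There    *)
(* is no rule (the machine is stuck) for a comparison query about a set that  *)
(* is not a common independent set, nor for storing a value, or writing at an *)
(* array index, that is not a machine word, i.e. not below W.                 *)
Inductive exec (R : realType) (U : finType) (M1 M2 : matroid U) (w : U -> R)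
    (W : nat) : cmd -> store -> nat -> nat -> store -> Prop :=
| ExecSkip s : exec M1 M2 w W Skip s 0 1 s
| ExecAssign x e s :
    eval s e < W ->
    exec M1 M2 w W (Assign x e) s 0 (esize e).+1 (set_var s x (eval s e))
| ExecPut a i e s :
    eval s i < W -> eval s e < W ->
    exec M1 M2 w W (Put a i e) s 0 (esize i + esize e).+1
      (set_arr s a (eval s i) (eval s e))
| ExecSeq p1 p2 s s1 s2 q1 q2 t1 t2 :
    exec M1 M2 w W p1 s q1 t1 s1 -> exec M1 M2 w W p2 s1 q2 t2 s2 ->
    exec M1 M2 w W (Seq p1 p2) s (q1 + q2) (t1 + t2) s2
| ExecIf e p1 p2 s s' q t :
    exec M1 M2 w W (if eval s e != 0 then p1 else p2) s q t s' ->
    exec M1 M2 w W (If e p1 p2) s q ((esize e).+1 + t) s'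
| ExecWhileEnd e p s :
    eval s e = 0 ->
    exec M1 M2 w W (While e p) s 0 (esize e).+1 s
| ExecWhileLoop e p s s1 s2 q1 q2 t1 t2 :
    eval s e != 0 ->
    exec M1 M2 w W p s q1 t1 s1 -> exec M1 M2 w W (While e p) s1 q2 t2 s2 ->
    exec M1 M2 w W (While e p) s (q1 + q2) ((esize e).+1 + t1 + t2) s2
| ExecIndep1 x a i s :
    exec M1 M2 w W (Indep1 x a i) s 0 (esize i).+1
      (set_var s x (M1 (set_at U s a (eval s i))))
| ExecIndep2 x a i s :
    exec M1 M2 w W (Indep2 x a i) s 0 (esize i).+1
      (set_var s x (M2 (set_at U s a (eval s i))))
| ExecCompare x a i b j s :
    common M1 M2 (set_at U s a (eval s i)) ->
    common M1 M2 (set_at U s b (eval s j)) ->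
    exec M1 M2 w W (Compare x a i b j) s 1 (esize i + esize j).+1
      (set_var s x (compare_weights w (set_at U s a (eval s i))
                                      (set_at U s b (eval s j)))).

(* Runs are unique, so that "the program has a run such that ..." is a        *)
(* statement about its only run.                                              *)
Lemma exec_det (R : realType) (U : finType) (M1 M2 : matroid U) (w : U -> R)
    (W : nat) (p : cmd) (s : store) (q t : nat) (s' : store) :
  exec M1 M2 w W p s q t s' ->
  forall q' t' s'', exec M1 M2 w W p s q' t' s'' ->
  [/\ q' = q, t' = t & s'' = s'].
Proof.
elim=> *;
  match goal with h : exec _ _ _ _ _ _ _ _ _ |- [/\ _, _ & _] =>
    inversion h; subst end;
  repeat match goal with
  | IH : forall q' t' s'', exec _ _ _ _ ?p1 ?s1 q' t' s'' -> _,
    h : exec _ _ _ _ ?p1 ?s1 _ _ _ |- _ =>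
      case: (IH _ _ _ h) => ? ? ?; subst; clear IH
  end;
  first [by [] | by match goal with h0 : eval ?s0 ?e0 = 0,
                                    h1 : is_true (eval ?s0 ?e0 != 0) |- _ =>
                      rewrite h0 in h1 end].
Qed.

(* The input: n in variable 0, everything else zero.                          *)
Definition init (n : nat) : store :=
  Store (fun x => if x == 0 then n else 0) (fun _ _ => 0).

(* Words have O(log n) bits, i.e. range over the naturals below (n + 2)^k.    *)
Definition word_bound (k n : nat) : nat := (n + 2) ^ k.

(* The output set is left in the first n entries of array 0.                  *)
Definition output (U : finType) (s : store) : {set U} := set_at U s 0 0.

(* Main.v *)
Require Import Defs.
From mathcomp Require Import all_boot all_order all_algebra.
From mathcomp Require Import reals boolp zify lra.

(* Successive shortest augmenting paths.  Let S have minimum weight among the *)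
(* common independent sets of its size.  In the exchange graph, an arc u -> v *)
(* costs w v when v enters S and - w v when v leaves it.  Distances are       *)
(* computed by Bellman-Ford, and the label of v is the set A_v obtained from  *)
(* S along the best walk to v found so far.  Only common independent sets may *)
(* be compared: labels competing for v are compared after removing v, and     *)
(* those for which A_v \ v is not common independent are discarded.  This     *)
(* loses nothing, since along a shortest walk with as few arcs as possible    *)
(* the exchange pairs are acyclically ordered, so that Krogdahl's lemma makes *)
(* the result independent; relaxing in synchronous phases and replacing a     *)
(* label only on strict improvement keeps the number of arcs minimal.         *)
(* Optimality is certified by a weight splitting w = w1 + w2, updated with    *)
(* the distances: at most n augmentations of 2n phases, each examining n^2    *)
(* arcs at constant cost.                                                     *)

Set Implicit Arguments.
Unset Strict Implicit.
Unset Printing Implicit Defensive.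

Import Order.TTheory GRing.Theory Num.Theory.

(** * Matroids *)


(** A set S that is lightest among the common independent sets of its size is certified by a
    splitting w = w1 + w2 for which S is lightest of its size in M1 for w1 and in M2 for w2. The
    splitting is a potential on the exchange graph, so closed walks have nonnegative cost and
    distances D with hop numbers H exist ([distances_exist]). In turn D splits w for the next size
    ([augment_split_optimal]): every common independent set with |S| + 1 elements weighs at least
    w(S) + D(t), where t is a nearest reachable sink. Any common independent set of that size and
    weight will do, whether or not it stems from a shortest path.

    Such a set exists by Krogdahl's lemma [indep_exchange_matching]: the exchanges along a cheapest
    walk with fewest arcs are ordered by D, then H ([chain_indep1], [chain_indep2], [chain_sink]).
    By [relaxed_label_inv], Bellman-Ford finds it although weights are seen only through comparisons
    of common independent sets. If no sink is reachable, S has maximum size ([no_augmenting_path]).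
    Weights may be negative, so the output is the lightest of the successive sets.

    The program is verified by total-correctness rules carrying a time bound read off the syntax:
    four nested loops of at most n rounds. Each query takes time, so the same bound covers the
    queries. *)

Section Matroid.
Variables (U : finType) (M : matroid U).
Implicit Types (S T Z : {set U}) (x y z : U).

Lemma indep_extend S T : M S -> M T -> #|S| <= #|T| ->
  exists X : {set U}, [/\ S \subset X, X \subset S :|: T, M X & #|X| = #|T|].
Proof.
move=> MS MT; have [k] := ubnP (#|T| - #|S|); elim: k S MS => // k IH S MS lek leST.
have [eqST|neST] := eqVneq #|S| #|T|.
  by exists S; split=> //; rewrite subsetUl.
have ltST : #|S| < #|T| by rewrite ltn_neqAle neST.
have [x /setDP [xT xS] MxS] := indep_aug MS MT ltST.
have cx : #|x |: S| = #|S|.+1 by rewrite cardsU1 xS.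
have [||X [sX Xs MX cX]] := IH _ MxS; rewrite ?cx //; first by lia.
exists X; split=> //; first by apply: subset_trans sX; apply: subsetUr.
apply: (subset_trans Xs); apply/subsetP=> z; rewrite !inE.
by case/orP=> [/orP[/eqP->|->]|->]; rewrite ?xT ?orbT.
Qed.

(** Unless Z = S, extend y |: Z inside y |: S to the size of S; the result omits an element of S,
    which lies outside Z. *)
Lemma indep_extend_exchange S Z y : M S -> y \notin S -> Z \subset S ->
  M (y |: Z) ->
  M (y |: S) \/ exists2 x, x \in S :\: Z & M (y |: (S :\ x)).
Proof.
move=> MS yS ZS MyZ.
have yZ : y \notin Z by apply: contra yS; apply: (subsetP ZS).
have [leZ|] := leqP #|y |: Z| #|S|; last first.
  rewrite cardsU1 yZ add1n ltnS => leSZ; left.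
  suff <- : Z = S by [].
  by apply/eqP; rewrite eqEcard ZS.
have [X [sX Xs MX cX]] := indep_extend MyZ MS leZ; right.
have yX : y \in X by apply: (subsetP sX); rewrite setU11.
have XyS : X \subset y |: S.
  apply: (subset_trans Xs); rewrite -setUA; apply: setUS.
  by rewrite subUset ZS subxx.
have [x xS xX] : exists2 x, x \in S & x \notin X.
  apply/subsetPn; apply/negP => SX.
  have : y |: S \subset X by rewrite subUset sub1set yX.
  by move/subset_leq_card; rewrite cardsU1 yS; lia.
exists x.
  rewrite inE xS andbT; apply: contra xX => xZ; apply: (subsetP sX).
  by rewrite inE xZ orbT.
suff <- : X = y |: (S :\ x) by [].
apply/eqP; rewrite eqEcard; apply/andP; split.
  apply/subsetP=> z zX; have := subsetP XyS _ zX; rewrite !inE.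
  case/orP=> [->//|->]; rewrite andbT; apply/orP; right.
  by apply: contraNneq xX => <-.
have xy : x != y by apply: contraNneq yS => <-.
by rewrite cardsU1 !inE (negPf yS) andbF cX [leqRHS](cardsD1 x) xS.
Qed.

(* By the last hypothesis T lies in the span of S, so both have the same span. *)
Lemma indep_add_transfer S T z : M S -> M T -> #|T| = #|S| -> z \notin S ->
  M (z |: S) -> (forall y, y \in T :\: S -> ~~ M (y |: S)) -> M (z |: T).
Proof.
move=> MS MT cTS zS MzS noy.
have lt : #|T| < #|z |: S| by rewrite cardsU1 zS cTS.
have [e /setDP [ezS eT] MeT] := indep_aug MT MzS lt.
move: ezS; rewrite !inE => /orP [/eqP<-//|eS].
have lt2 : #|S| < #|e |: T| by rewrite cardsU1 eT cTS.
have [y /setDP [yeT yS] MyS] := indep_aug MS MeT lt2.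
move: yeT; rewrite !inE => /orP [/eqP ye|yT]; first by rewrite ye eS in yS.
by have := noy y; rewrite inE yS yT MyS => /(_ isT).
Qed.

(* Krogdahl's lemma.  The acyclicity hypothesis holds when the matching       *)
(* [y -> f y] is the unique perfect matching of the exchange graph on J.      *)
Lemma indep_exchange_matching S (J : {set U}) (f : U -> U) : M S ->
  {in J, forall y, y \notin S} -> {in J, forall y, f y \in S} ->
  {in J &, injective f} ->
  {in J, forall y, M (y |: (S :\ f y))} ->
  (forall J' : {set U}, J' \subset J -> J' != set0 ->
     exists2 y, y \in J' &
       {in J', forall y', y' != y -> ~~ M (y' |: (S :\ f y))}) ->
  M ((S :\: f @: J) :|: J).
Proof.
have [k] := ubnP #|J|; elim: k J S => // k IH J S cJ MS JS fS finj Mf acyc.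
have [->|J0] := eqVneq J set0; first by rewrite imset0 setD0 setU0.
have [y yJ ymax] := acyc J (subxx _) J0.
have yS := JS y yJ; have fyS := fS y yJ.
(* The exchange of the extremal y is made first; induction then treats J \ y on [S1]. *)
pose S1 := y |: (S :\ f y).
have inS1 z : (z \in S1) = (z == y) || ((z != f y) && (z \in S)) by rewrite !inE.
have nf z : z \in J :\ y -> f z != f y.
  rewrite !inE => /andP [zy zJ]; apply: contra zy => /eqP e.
  by apply/eqP; apply: finj.
have cardS1 : #|S1| = #|S|.
  by rewrite cardsU1 !inE (negPf yS) andbF [RHS](cardsD1 (f y)) fyS.
have -> : (S :\: f @: J) :|: J = (S1 :\: f @: (J :\ y)) :|: (J :\ y).
  apply/setP => z; rewrite !(inE, inS1).
  have [->|zy] := eqVneq z y; rewrite /=.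
    rewrite yJ orbT; apply/esym; rewrite orbF andbT; apply/imsetP.
    by case=> u; rewrite !inE => /andP [_ uJ] e; have := fS _ uJ; rewrite -e (negPf yS).
  have -> : (z \in f @: J) = (z == f y) || (z \in f @: (J :\ y)).
    by rewrite -{1}(setD1K yJ) imsetU imset_set1 !inE.
  by rewrite negb_or; case: (z == f y) => //=; rewrite ?andbF ?andbT.
have in1 z : z \in J :\ y -> M (z |: ((S :\ f y) :\ f z)).
  move=> zJy; have := zJy; rewrite !inE => /andP [zy zJ].
  apply: indep_sub (Mf z zJ); apply: setUS.
  by apply/subsetP => u; rewrite !inE => /andP [-> /andP [_ ->]].
have cD2 z : z \in J -> f z != f y -> #|S| = #|(S :\ f y) :\ f z|.+2.
  move=> zJ ne; rewrite (cardsD1 (f y) S) fyS (cardsD1 (f z) (S :\ f y)).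
  by rewrite !inE ne (fS z zJ) !add1n.
have cD z : z \in J :\ y -> #|z |: ((S :\ f y) :\ f z)| < #|S|.
  move=> zJy; have ne := nf z zJy; move: zJy; rewrite !inE => /andP [zy zJ].
  by rewrite (cD2 z zJ ne) cardsU1; case: (_ \notin _).
apply: IH.
- by move: cJ; rewrite (cardsD1 y) yJ; lia.
- exact: Mf.
- move=> z; rewrite !inE => /andP [zy zJ].
  by rewrite (negPf zy) (negPf (JS z zJ)) andbF.
- by move=> z zJy; rewrite inS1 (nf z zJy) fS ?orbT //; move: zJy; rewrite !inE => /andP [].
- by move=> a b; rewrite !inE => /andP [_ aJ] /andP [_ bJ]; apply: finj.
(* Exchange pairs survive: augmenting z |: (S \ f y \ f z) from [S1] adds y, as wanted, or f z,
   which would exchange z with f y against the choice of y. *)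
- move=> z zJy; have zJy' := zJy; move: zJy'; rewrite !inE => /andP [zy zJ].
  have lt : #|z |: ((S :\ f y) :\ f z)| < #|S1| by rewrite cardS1 cD.
  have [e /setDP [eS1 enot] Me] := indep_aug (in1 z zJy) (Mf y yJ) lt.
  have : e \in [set y; f z].
    move: eS1 enot; rewrite !inE negb_or !negb_and !negbK.
    case/orP=> [->//|/andP [ne eS]] /andP [_].
    by rewrite (negPf ne) eS /= !orbF => ->; rewrite orbT.
  rewrite !inE => /orP [] /eqP ee; subst e.
    apply: indep_sub Me; apply/subsetP => u; rewrite !inE.
    by case/orP=> [->|/andP [->/orP [->|->]]]; rewrite ?orbT.
  have : M (z |: (S :\ f y)).
    apply: indep_sub Me; apply/subsetP => u; rewrite !inE.
    by case/orP=> [->|/andP [-> ->]]; rewrite ?orbT //=; case: (u == f z); rewrite ?orbT.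
  by rewrite (negPf (ymax z zJ zy)).
(* The order survives: an exchange of v with f u in [S1], augmented from S, gives one in S of v with
   f u or with f y. *)
- move=> J' J'J J'0; have J'J2 : J' \subset J.
    by apply: (subset_trans J'J); rewrite subD1set.
  have [u uJ' umax] := acyc J' J'J2 J'0; exists u => // v vJ' vu.
  have vJy := subsetP J'J v vJ'; have uJy := subsetP J'J u uJ'.
  have vJy' := vJy; move: vJy'; rewrite !inE => /andP [vy vJ].
  have uJy' := uJy; move: uJy'; rewrite !inE => /andP [uy uJ].
  apply/negP => Mv.
  have vS := JS v vJ.
  have Mv' : M (v |: ((S :\ f y) :\ f u)).
    apply: indep_sub Mv; apply/subsetP => t; rewrite !inE.
    by case/orP=> [->|/andP [-> /andP [-> ->]]]; rewrite ?orbT.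
  have lt : #|v |: ((S :\ f y) :\ f u)| < #|S|.
    by rewrite (cD2 u uJ (nf u uJy)) cardsU1; case: (_ \notin _).
  have [e /setDP [eS enot] Me] := indep_aug Mv' MS lt.
  have : e \in [set f y; f u].
    by move: enot; rewrite !inE eS; case: (e == f y); case: (e == f u); rewrite ?orbT.
  rewrite !inE => /orP [] /eqP ee; subst e.
    have : M (v |: (S :\ f u)).
      apply: indep_sub Me; apply/subsetP => t; rewrite !inE.
      by case/orP=> [->|/andP [-> ->]]; rewrite ?orbT //=; case: (t == f y); rewrite ?orbT.
    by rewrite (negPf (umax v vJ' vu)).
  have : M (v |: (S :\ f y)).
    apply: indep_sub Me; apply/subsetP => t; rewrite !inE.
    by case/orP=> [->|/andP [-> ->]]; rewrite ?orbT //=; case: (t == f u); rewrite ?orbT.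
  by rewrite (negPf (ymax v vJ vy)).
Qed.

End Matroid.

(** * Minimum-weight independent sets of one matroid *)

Section MinWeight.
Local Open Scope ring_scope.
Variables (R : realType) (U : finType).
Implicit Types (M : matroid U) (w : U -> R) (S T : {set U}) (x y : U).

Lemma weightU1 w x S : x \notin S -> weight w (x |: S) = w x + weight w S.
Proof. by move=> xS; rewrite /weight big_setU1. Qed.

Lemma weightD1 w x S : x \in S -> weight w (S :\ x) = weight w S - w x.
Proof. by move=> xS; rewrite /weight (big_setD1 x xS) /= [RHS]addrC addKr. Qed.

Definition min_weight_indep M w S : Prop :=
  M S /\ forall T, M T -> #|T| = #|S| -> weight w S <= weight w T.

(** Replacing the heaviest y of T \ S by a suitable element of S brings T closer to S without
    raising its weight. *)
Lemma min_weight_indepP M w S : M S ->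
  (forall x y, x \in S -> y \notin S -> M (y |: (S :\ x)) -> w x <= w y) ->
  min_weight_indep M w S.
Proof.
move=> MS loc; split=> // T; have [k] := ubnP #|T :\: S|.
elim: k T => // k IH T lek MT cTS.
have [TS0|TS] := eqVneq (T :\: S) set0.
  suff -> : T = S by [].
  by apply/eqP; rewrite eqEcard cTS leqnn andbT -setD_eq0 TS0.
have [y0 y0TS] := set0Pn _ TS.
case: (arg_maxP w y0TS) => y yTS ymax; have /setDP [yT yS] := yTS.
have MTy : M (T :\ y) by apply: indep_sub MT; apply: subD1set.
have lt : (#|T :\ y| < #|S|)%N by rewrite -cTS (cardsD1 y T) yT.
have [x /setDP [xS xTy] MxT] := indep_aug MTy MS lt.
have xy : x != y by apply: contraNneq yS => <-.
have xT : x \notin T by move: xTy; rewrite !inE xy.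
(* In S, x can be swapped with some z of T \ S, so w x <= w z, and y is the heaviest such
   element. *)
have lexy : w x <= w y.
  have MSx : M (S :\ x) by apply: indep_sub MS; apply: subD1set.
  have ltx : (#|S :\ x| < #|T|)%N by rewrite cTS (cardsD1 x S) xS.
  have [z /setDP [zT zSx] MzS] := indep_aug MSx MT ltx.
  have zx : z != x by apply: contraNneq xT => <-.
  have zS : z \notin S by move: zSx; rewrite !inE zx.
  apply: le_trans (loc x z xS zS MzS) _; apply: ymax.
  exact/setDP.
have cT' : #|x |: (T :\ y)| = #|S|.
  by rewrite cardsU1 xTy -cTS (cardsD1 y T) yT.
apply: le_trans (IH _ _ MxT cT') _.
  have yTS' : y \in T :\: S by [].
  rewrite -ltnS; apply: leq_trans lek.
  rewrite ltnS (cardsD1 y (T :\: S)) yTS' add1n ltnS; apply: subset_leq_card.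
  apply/subsetP => z; rewrite !inE => /andP [zS /orP [/eqP zx|/andP [-> ->]]].
    by rewrite zx xS in zS.
  by rewrite zS.
by rewrite weightU1 // weightD1 // addrCA gerDl subr_le0.
Qed.

Lemma min_weight_indep_succ M w S (a : R) : min_weight_indep M w S ->
  (forall y, y \notin S -> M (y |: S) -> a <= w y) ->
  forall T, M T -> #|T| = #|S|.+1 -> weight w S + a <= weight w T.
Proof.
move=> [MS minS] lea T MT cT.
have lt : (#|S| < #|T|)%N by rewrite cT.
have [y /setDP [yT yS] MyS] := indep_aug MS MT lt.
have cTy : #|T :\ y| = #|S| by move: cT; rewrite (cardsD1 y T) yT => -[].
have MTy : M (T :\ y) by apply: indep_sub MT; apply: subD1set.
have := minS _ MTy cTy; rewrite weightD1 // => leT.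
have := lea y yS MyS; lra.
Qed.

End MinWeight.

(** * Shortest walks *)


Section ShortestWalks.
Local Open Scope ring_scope.
Variables (R : realType) (U : finType).
Variables (e : rel U) (src : pred U) (c : U -> R).
Implicit Types (p : seq U) (u v : U).

(* [D v] is the least cost of a walk from a source to [v], and [H v] the      *)
(* least number of arcs of a walk of that cost.                               *)
Record distances (reach : pred U) (D : U -> R) (H : U -> nat) : Prop :=
  Distances {
    reach_src : forall v, src v -> reach v;
    reach_edge : forall u v, reach u -> e u v -> reach v;
    dist_src : forall v, src v -> D v <= c v;
    dist_edge : forall u v, reach u -> e u v -> D v <= D u + c v;
    hops0 : forall v, reach v -> H v = 0%N -> src v /\ D v = c v;
    hopsS : forall v h, reach v -> H v = h.+1 ->
      exists u, [/\ reach u, e u v, H u = h & D v = D u + c v];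
    hops_src : forall v, src v -> D v = c v -> H v = 0%N;
    hops_edge : forall u v, reach u -> e u v -> D v = D u + c v ->
      (H v <= (H u).+1)%N;
    hops_lt : forall v, reach v -> (H v < #|U|)%N }.

Definition walk p v : bool :=
  if p is x :: p' then [&& src x, path e x p' & last x p' == v] else false.

Definition cost p : R := \sum_(u <- p) c u.

Lemma cost_rcons p v : cost (rcons p v) = cost p + c v.
Proof. by rewrite /cost -cats1 big_cat big_seq1. Qed.

Lemma walk_rcons p u v : walk p u -> e u v -> walk (rcons p v) v.
Proof.
case: p => //= x p /and3P [-> xp /eqP lp] uv.
by rewrite rcons_path last_rcons xp lp uv eqxx.
Qed.

Variable q : U -> R.
Hypothesis potential : forall u v, e u v -> q v - q u <= c v.

Lemma path_cost_ge u p : path e u p -> q (last u p) - q u <= cost p.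
Proof.
elim: p u => [|v p IH] u /=; first by rewrite subrr /cost big_nil.
move=> /andP [uv vp]; have := IH v vp; have := potential uv.
by rewrite /cost big_cons; lra.
Qed.

Lemma not_uniq_split p : ~~ uniq p ->
  exists u p1 p2 p3, p = p1 ++ u :: p2 ++ u :: p3.
Proof.
elim: p => //= x p IH; rewrite negb_and negbK => /orP [xp|/IH].
  by case/splitPr: xp => p1 p2; exists x, [::], p1, p2.
by case=> u [p1 [p2 [p3 ->]]]; exists u, (x :: p1), p2, p3.
Qed.

(* Closed walks have nonnegative cost, because of the potential [q]. *)
Lemma walk_shorten p v : walk p v -> ~~ uniq p ->
  exists p', [/\ walk p' v, (size p' < size p)%N & cost p' <= cost p].
Proof.
move=> wp /not_uniq_split [u [p1 [p2 [p3 ep]]]]; exists (p1 ++ u :: p3).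
have cyc : path e u (rcons p2 u) /\ walk (p1 ++ u :: p3) v.
  move: wp; rewrite {}ep; case: p1 => [|x p1] /=.
    rewrite cat_path last_cat rcons_path /=.
    by move=> /and3P [-> /and3P [-> -> ->] ->].
  rewrite !cat_path !last_cat /= cat_path last_cat rcons_path /=.
  by move=> /and3P [-> /and3P [-> -> /and3P [-> -> ->]] ->].
split; first exact: cyc.2.
  by rewrite ep !size_cat /= !size_cat /=; lia.
have := path_cost_ge cyc.1; rewrite last_rcons subrr cost_rcons ep /cost.
by rewrite !big_cat /= !big_cons big_cat /= big_cons; lra.
Qed.

Lemma walk_bounded p v : walk p v ->
  exists p', [/\ walk p' v, (size p' <= #|U|)%N & cost p' <= cost p].
Proof.
have [k] := ubnP (size p); elim: k p => // k IH p lek wp.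
have [le|gt] := leqP (size p) #|U|; first by exists p.
have : ~~ uniq p.
  by apply/negP => /card_uniqP sp; move: gt; rewrite -sp ltnNge max_card.
move=> /(walk_shorten wp) [p1 [wp1 lt le]].
have [|p2 [wp2 le2 lec]] := IH p1 _ wp1; first exact: leq_trans lt _.
by exists p2; split=> //; apply: le_trans lec le.
Qed.

Definition shortest p v : Prop :=
  [/\ walk p v, (size p <= #|U|)%N, forall p', walk p' v -> cost p <= cost p' &
      forall p', walk p' v -> cost p' = cost p -> (size p <= size p')%N].

Lemma shortest_exists p v : walk p v -> exists p', shortest p' v.
Proof.
move=> /walk_bounded [p0 [wp0 sp0 _]].
(* Minima are taken over the finite type of sequences of length at most n; [walk_bounded] carries
   the least cost over to all walks. *)
pose P (b : #|U|.-bseq U) := walk b v.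
have Pb0 : P (Bseq sp0) by [].
case: (arg_minP (fun b : #|U|.-bseq U => cost b) Pb0) => b1 Pb1 min1.
pose P2 (b : #|U|.-bseq U) := walk b v && (cost b == cost b1).
have Pb2 : P2 b1 by rewrite /P2 eqxx andbT.
case: (arg_minnP (fun b : #|U|.-bseq U => size b) Pb2) => b /andP [wb /eqP cb] minb.
exists b; split=> //; first exact: size_bseq.
  move=> p' /walk_bounded [p2 [wp2 sp2 le]]; rewrite cb.
  by apply: le_trans le; apply: (min1 (Bseq sp2)).
move=> p' wp' ce; have [le|gt] := leqP (size p') #|U|.
  by apply: (minb (Bseq le)); rewrite /P2 /= wp' ce cb eqxx.
by apply: leq_trans (ltnW gt); apply: size_bseq.
Qed.

Lemma distances_exist : exists reach D H, distances reach D H.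
Proof.
have /choice [P Pshort] v : exists p', forall p, walk p v -> shortest p' v.
  have [[p wp]|no] := EM (exists p, walk p v); last first.
    by exists [::] => p wp; case: no; exists p.
  by have [p' sp'] := shortest_exists wp; exists p'.
pose reach v := walk (P v) v.
have reachP p v : walk p v -> shortest (P v) v by exact: Pshort.
have rw p v : walk p v -> reach v by move=> /reachP [].
have sP v : reach v -> shortest (P v) v by exact: Pshort.
have wsrc v : src v -> walk [:: v] v by move=> sv /=; rewrite sv eqxx.
have we u v : reach u -> e u v -> walk (rcons (P u) v) v.
  by move=> ru uv; apply: walk_rcons uv.
have P0 v : reach v -> size (P v) = (size (P v)).-1.+1.
  by rewrite /reach; case: (P v).
exists reach, (fun v => cost (P v)), (fun v => (size (P v)).-1).
have De u v : reach u -> e u v -> cost (P v) <= cost (P u) + c v.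
  move=> ru uv; have wv := we u v ru uv; have [_ _ + _] := sP v (rw _ _ wv).
  by move=> /(_ _ wv); rewrite cost_rcons.
have He u v : reach u -> e u v -> cost (P v) = cost (P u) + c v ->
    ((size (P v)).-1 <= (size (P u)).-1.+1)%N.
  move=> ru uv; have wv := we u v ru uv; have [_ _ _] := sP v (rw _ _ wv).
  move=> /(_ _ wv); rewrite cost_rcons size_rcons => le /esym/le.
  by rewrite -P0 //; case: (size (P v)).
split=> //.
- by move=> v /wsrc /rw.
- by move=> u v ru uv; apply: rw (we u v ru uv).
- move=> v /wsrc wv; have [_ _ + _] := sP v (rw _ _ wv) => /(_ _ wv).
  by rewrite {2}/cost big_seq1.
- move=> v rv; have [wv _ _ _] := sP v rv; move: wv.
  by case: (P v) => [|x [|y p]] //= /andP [sx /eqP <-]; rewrite /cost big_seq1.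
- move=> v h rv; have [wv _ _ _] := sP v rv; move: wv.
  case E: (P v) => [|x p'] //; case: (lastP p') E => // p y E /=.
  rewrite rcons_path last_rcons size_rcons => /and3P [sx /andP [xp lu] /eqP yv] [hp].
  subst y; set u := last x p in lu.
  have wu : walk (x :: p) u by rewrite /= sx xp eqxx.
  have ru := rw _ _ wu; have [_ _ leD leH] := sP u ru.
  have cv : cost (P v) = cost (x :: p) + c v by rewrite E -rcons_cons cost_rcons.
  have ceq : cost (x :: p) = cost (P u).
    by have := leD _ wu; have := De u v ru lu; rewrite cv; lra.
  exists u; split=> //; last by rewrite -E cv ceq.
  have := He u v ru lu; rewrite cv ceq E /= size_rcons => /(_ erefl).
  by have := leH _ wu ceq; have := P0 u ru; rewrite /=; lia.
- move=> v sv cv; have wv := wsrc v sv; have [_ _ _ leH] := sP v (rw _ _ wv).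
  have := leH _ wv; rewrite {1}/cost big_seq1 -cv => /(_ erefl) /=.
  by case: (size (P v)) => [|[]].
- by move=> v rv; have [_ le _ _] := sP v rv; rewrite -P0.
Qed.

End ShortestWalks.

(** * The exchange graph *)


Lemma card_exchange (U : finType) (S J : {set U}) (f : U -> U) :
  {in J, forall y, y \notin S} -> {in J, forall y, f y \in S} ->
  {in J &, injective f} -> #|(S :\: f @: J) :|: J| = #|S|.
Proof.
move=> JS fS finj; have sfS : f @: J \subset S.
  by apply/subsetP => _ /imsetP [y yJ ->]; apply: fS.
rewrite cardsU cardsD (setIidPr sfS) card_in_imset //.
have -> : (S :\: f @: J) :&: J = set0.
  apply/setP => z; rewrite !inE; case zJ: (z \in J); rewrite ?andbF //.
  by rewrite (negPf (JS z zJ)) andbF.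
by rewrite cards0 subn0 subnK // -(card_in_imset finj); apply: subset_leq_card.
Qed.

(** Supplies the extremal element that Krogdahl's lemma asks for: [g] comes from distances, and [k]
    breaks ties by the number of arcs. *)
Lemma exists_lex_max (R : realType) (U : finType) (J : {set U}) (g : U -> R)
    (k : U -> nat) : J != set0 ->
  exists2 y, y \in J &
    {in J, forall z, (g z <= g y)%R /\ (g z = g y -> k z <= k y)}.
Proof.
case/set0Pn=> y0 y0J; case: (arg_maxP g y0J) => y1 y1J max1.
have P2 : (y1 \in J) && (g y1 == g y1) by rewrite eqxx andbT.
case: (arg_maxnP k (P := fun y => (y \in J) && (g y == g y1)) P2).
move=> y /andP [yJ /eqP gy] max2; exists y => // z zJ; rewrite gy.
by split; [apply: max1 | move=> gz; apply: max2; rewrite zJ gz eqxx].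
Qed.

Definition symdiff (U : finType) (S C : {set U}) := (S :\: C) :|: (C :\: S).

Section Exchange.
Local Open Scope ring_scope.
Variables (R : realType) (U : finType) (M1 M2 : matroid U) (w : U -> R).
Variable S : {set U}.
Implicit Types (u v x y z : U) (A C T : {set U}).

(** Along a path, an element outside S is exchanged with its successor for M2 and with its
    predecessor for M1. So the source has no partner for M1, and the final sink none for M2. *)
Definition edge u v : bool :=
  if v \in S then (u \notin S) && M2 (u |: (S :\ v))
  else (u \in S) && M1 (v |: (S :\ u)).
Definition source v : bool := (v \notin S) && M1 (v |: S).
Definition sink v : bool := (v \notin S) && M2 (v |: S).
Definition gain v : R := if v \in S then - w v else w v.

Lemma edge_notin u v : edge u v -> (u \in S) = (v \notin S).
Proof. by rewrite /edge; case: (v \in S) => /andP [] => [/negPf|]. Qed.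

Lemma gain_in v : v \in S -> gain v = - w v.
Proof. by rewrite /gain => ->. Qed.

Lemma gain_notin v : v \notin S -> gain v = w v.
Proof. by rewrite /gain => /negPf ->. Qed.

Variables (reach : pred U) (D : U -> R) (H : U -> nat).
Hypothesis dist : distances edge source gain reach D H.
Hypotheses (M1S : M1 S) (M2S : M2 S).

Lemma odd_hops v : reach v -> odd (H v) = (v \in S).
Proof.
have [k] := ubnP (H v); elim: k v => // k IH v lt rv.
case Hv: (H v) => [|h].
  by have [/andP [/negPf-> _] _] := hops0 dist rv Hv.
have [u [ru uv Hu _]] := hopsS dist rv Hv.
by rewrite /= -Hu IH ?(edge_notin uv) ?negbK //; rewrite Hv in lt; rewrite Hu.
Qed.

(** A shortest walk indexed by hop numbers: H recovers the position of a vertex, so the vertices are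
    distinct. *)
Definition tight_chain (ch : nat -> U) (h : nat) : Prop :=
  [/\ forall i, (i <= h)%N -> reach (ch i) /\ H (ch i) = i,
      D (ch 0%N) = gain (ch 0%N) &
      forall i, (i < h)%N -> edge (ch i) (ch i.+1) /\
        D (ch i.+1) = D (ch i) + gain (ch i.+1)].

Definition chain_set (ch : nat -> U) (h : nat) : {set U} :=
  [set v | (H v <= h)%N && (ch (H v) == v)].

Lemma tight_chainW ch h h' : (h' <= h)%N -> tight_chain ch h ->
  tight_chain ch h'.
Proof.
move=> le [c1 c2 c3]; split=> // i lei; first by apply: c1; apply: leq_trans le.
by apply: c3; apply: leq_trans le.
Qed.

Lemma mem_chain ch h i : tight_chain ch h -> (i <= h)%N ->
  (ch i \in S) = odd i.
Proof. by move=> [c1 _ _] /c1 [ri Hi]; rewrite -odd_hops // Hi. Qed.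

Lemma mem_chain_set ch h i : tight_chain ch h -> (i <= h)%N ->
  ch i \in chain_set ch h.
Proof. by move=> [c1 _ _] lei; have [ri Hi] := c1 i lei; rewrite inE Hi lei eqxx. Qed.

Lemma chain_setP ch h v : v \in chain_set ch h ->
  exists i, [/\ (i <= h)%N, v = ch i & H v = i].
Proof. by rewrite inE => /andP [le /eqP e]; exists (H v). Qed.

(* The exchange pairs are ordered by distance and then by number of arcs: an  *)
(* arc against this order would be tight and would shorten the chain.         *)
Lemma chain_indep2 ch h : tight_chain ch h -> odd h ->
  M2 (symdiff S (chain_set ch h)) /\ #|symdiff S (chain_set ch h)| = #|S|.
Proof.
move=> cch oh; have [c1 c2 c3] := cch.
set C := chain_set ch h; pose J := C :\: S; pose f y := ch (H y).+1.
have JP y : y \in J -> exists i, [/\ (i < h)%N, y = ch i, H y = i & ~~ odd i].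
  move=> /setDP [yC yS]; have [i [lei ei Hi]] := chain_setP yC.
  have oi : ~~ odd i by rewrite -(mem_chain cch lei) -ei.
  by exists i; split=> //; rewrite ltn_neqAle lei andbT; apply: contraNneq oi => ->.
have JS : {in J, forall y, y \notin S} by move=> y /setDP [].
have fS : {in J, forall y, f y \in S}.
  by move=> y /JP [i [lti _ Hi oi]]; rewrite /f Hi (mem_chain cch lti) /=.
have finj : {in J &, injective f}.
  move=> y y' /JP [i [lti ey Hi _]] /JP [j [ltj ey' Hj _]]; rewrite /f Hi Hj.
  move=> e; have := (c1 i.+1 lti).2; rewrite e (c1 j.+1 ltj).2 => -[ji].
  by rewrite ey ey' ji.
have fim : f @: J = C :&: S.
  apply/setP => x; apply/imsetP/setIP.
    case=> y yJ ->; split; last exact: fS.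
    by have [i [lti ey Hi _]] := JP y yJ; rewrite /f Hi (mem_chain_set cch).
  case=> xC xS; have [i [lei ex Hx]] := chain_setP xC.
  have oi : odd i by rewrite -(mem_chain cch lei) -ex.
  case: i oi lei ex Hx => //= i oi lei ex Hx.
  exists (ch i); last by rewrite /f (c1 i (ltnW lei)).2.
  by rewrite inE (mem_chain cch (ltnW lei)) oi (mem_chain_set cch (ltnW lei)).
have -> : symdiff S C = (S :\: f @: J) :|: J.
  rewrite fim /symdiff /J; congr (_ :|: _).
  by rewrite setDIr setDv setU0.
split; last exact: card_exchange.
apply: indep_exchange_matching => //.
  move=> y yJ; have [i [lti ey Hi oi]] := JP y yJ.
  have [] := c3 i lti; rewrite /edge (mem_chain cch lti) /= oi => /andP [_].
  by rewrite /f Hi -ey.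
move=> J' J'J J'0; have [y yJ' ymax] := exists_lex_max D H J'0.
exists y => // y' y'J' ney; apply/negP => My'.
have yJ := subsetP J'J y yJ'; have y'J := subsetP J'J y' y'J'.
have [i [lti ey Hi oi]] := JP y yJ; have [j [ltj ey' Hj oj]] := JP y' y'J.
have [ry' _] := c1 j (ltnW ltj); rewrite -ey' in ry'.
have e' : edge y' (f y) by rewrite /edge (fS y yJ) (JS y' y'J) My'.
have Df : D (f y) = D y + gain (f y).
  by have [_] := c3 i lti; rewrite /f Hi -ey.
have [le1 le2] := ymax y' y'J'.
have := dist_edge dist ry' e'; rewrite Df lerD2r => le3.
have eD : D y' = D y by apply/le_anti; rewrite le1 le3.
have := hops_edge dist ry' e'; rewrite Df eD => /(_ erefl).
rewrite {1}/f Hi (c1 i.+1 lti).2 ltnS => leH.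
have := le2 eD; rewrite Hi Hj => leji.
have eij : i = j by apply/eqP; rewrite eqn_leq leji -Hj leH.
by move: ney; rewrite ey ey' eij eqxx.
Qed.

(** Each chain vertex outside S but the first is exchanged with its predecessor, by Krogdahl's
    lemma; the first is then added by [indep_add_transfer]. *)
Lemma chain_indep1 ch h : tight_chain ch h -> ~~ odd h ->
  M1 (symdiff S (chain_set ch h)).
Proof.
move=> cch oh; have [c1 c2 c3] := cch.
set C := chain_set ch h; pose J := (C :\: S) :\ ch 0%N.
pose f y := ch (H y).-1.
have [r0 H0] := c1 0%N (leq0n _).
have [/andP [S0 M1s0] D0] := hops0 dist r0 H0.
have JP y : y \in J ->
    exists i, [/\ (i.+1 <= h)%N, y = ch i.+1, H y = i.+1 & odd i].
  rewrite !inE => /and3P [ne yS yC]; have yC' : y \in C by rewrite inE.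
  have [i [lei ei Hi]] := chain_setP yC'.
  have oi : ~~ odd i by rewrite -(mem_chain cch lei) -ei.
  case: i lei ei Hi oi => [|i] lei ei Hi oi; first by rewrite ei eqxx in ne.
  by exists i; split=> //; rewrite /= negbK in oi.
have JS : {in J, forall y, y \notin S} by move=> y; rewrite !inE => /and3P [].
have fS : {in J, forall y, f y \in S}.
  by move=> y /JP [i [lti _ Hi oi]]; rewrite /f Hi /= (mem_chain cch (ltnW lti)).
have fchain y i : H y = i.+1 -> f y = ch i by rewrite /f => ->.
have finj : {in J &, injective f}.
  move=> y y' /JP [i [lti ey Hi _]] /JP [j [ltj ey' Hj _]].
  rewrite (fchain _ _ Hi) (fchain _ _ Hj).
  move=> e; have := (c1 i (ltnW lti)).2; rewrite e (c1 j (ltnW ltj)).2 => ji.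
  by rewrite ey ey' ji.
have fim : f @: J = C :&: S.
  apply/setP => x; apply/imsetP/setIP.
    case=> y yJ ->; split; last exact: fS.
    have [i [lti ey Hi _]] := JP y yJ.
    by rewrite (fchain _ _ Hi) (mem_chain_set cch) // ltnW.
  case=> xC xS; have [i [lei ex Hx]] := chain_setP xC.
  have oi : odd i by rewrite -(mem_chain cch lei) -ex.
  have lti : (i < h)%N by rewrite ltn_neqAle lei andbT; apply: contraNneq oh => <-.
  have Hi1 := (c1 i.+1 lti).2.
  exists (ch i.+1); last by rewrite (fchain _ _ Hi1).
  rewrite !in_setD1 inE (mem_chain cch lti) /= oi (mem_chain_set cch lti) !andbT.
  by apply/eqP => e; have := Hi1; rewrite e H0.
pose T := (S :\: f @: J) :|: J.
have -> : symdiff S C = ch 0%N |: T.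
  have C0 : ch 0%N \in C by apply: mem_chain_set cch _.
  rewrite /T fim /symdiff setDIr setDv setU0 setUCA; congr (_ :|: _).
  by rewrite /J setD1K // inE S0.
have M1T : M1 T.
  apply: indep_exchange_matching => //.
    move=> y yJ; have [i [lti ey Hi oi]] := JP y yJ.
    have [] := c3 i lti; rewrite /edge (mem_chain cch lti) /= oi => /andP [_].
    by rewrite (fchain _ _ Hi) -ey.
  move=> J' J'J J'0.
  (* As D y = D (f y) + w y, a maximal w - D means a nearest predecessor; [#|U| - H v] then prefers
     fewer arcs. *)
  have [y yJ' ymax] := exists_lex_max (fun v => w v - D v) (fun v => #|U| - H v)%N J'0.
  exists y => // y' y'J' ney; apply/negP => My'.
  have yJ := subsetP J'J y yJ'; have y'J := subsetP J'J y' y'J'.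
  have [i [lti ey Hi oi]] := JP y yJ; have [j [ltj ey' Hj oj]] := JP y' y'J.
  have [ry' _] := c1 j.+1 ltj; rewrite -ey' in ry'.
  have rf : reach (f y) by rewrite (fchain _ _ Hi); apply: (c1 i (ltnW lti)).1.
  have e' : edge (f y) y' by rewrite /edge (negPf (JS y' y'J)) (fS y yJ) My'.
  have Df : D y = D (f y) + gain y.
    by have [_] := c3 i lti; rewrite (fchain _ _ Hi) -ey.
  rewrite (gain_notin (JS y yJ)) in Df.
  have [le1 le2] := ymax y' y'J'.
  have := dist_edge dist rf e'; rewrite (gain_notin (JS y' y'J)) => le3.
  have := hops_edge dist rf e'; rewrite (gain_notin (JS y' y'J)) => tight.
  have eD : D y' = D (f y) + w y' by lra.
  have := tight eD; rewrite (fchain _ _ Hi) (c1 i (ltnW lti)).2 => leH.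
  have := le2; rewrite Hi Hj.
  have -> : w y' - D y' = w y - D y by lra.
  move=> /(_ erefl) leji.
  have := hops_lt dist ry'; rewrite Hj => ltU.
  have eij : i = j by move: leH leji ltU; rewrite Hj; clear; lia.
  by move: ney; rewrite ey ey' eij eqxx.
apply: (indep_add_transfer M1S M1T) => //; first exact: card_exchange.
move=> y; rewrite !inE => /andP [yS]; rewrite (negPf yS) andbF /= => yJ0.
have yJ : y \in J by rewrite !inE yS; case/and3P: yJ0 => -> -> ->.
(* Were y a source, then D (ch i) <= 0, while the arc from ch i to the first vertex gives D (ch i)
   >= 0. So y would attain its distance as a source and have hop number 0. *)
apply/negP => M1y; have [i [lti ey Hi oi]] := JP y yJ.
have sy : source y by rewrite /source yS.
have xS : ch i \in S by rewrite (mem_chain cch (ltnW lti)).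
have [rx _] := c1 i (ltnW lti).
have e0 : edge (ch i) (ch 0%N).
  rewrite /edge (negPf S0) xS /=; apply: indep_sub M1s0; apply: setUS.
  exact: subD1set.
have := dist_edge dist rx e0; rewrite D0 -{1}[gain _]add0r lerD2r => Dx.
have := dist_src dist sy => le1.
have [_] := c3 i lti; rewrite -ey => Dy.
have : D y = gain y by lra.
by move/(hops_src dist sy); rewrite Hi.
Qed.

(** For M1, drop the last vertex: it belongs to S, so the shorter chain gives a superset. *)
Lemma chain_common ch h : tight_chain ch h -> odd h ->
  common M1 M2 (symdiff S (chain_set ch h)).
Proof.
move=> cch oh; have [M2C _] := chain_indep2 cch oh; rewrite /common M2C andbT.
case: h cch oh M2C => // h cch oh _.
apply: indep_sub (chain_indep1 (tight_chainW (leqnSn h) cch) oh).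
have hS : ch h.+1 \in S by rewrite (mem_chain cch (leqnn _)).
apply/subsetP => z; rewrite !inE; case zS: (z \in S); rewrite ?andbF ?andbT /= ?orbF.
  by apply: contra => /andP [le ->]; rewrite andbT (leq_trans le).
move=> /andP [le ez]; rewrite ez andbT -ltnS ltn_neqAle le andbT.
by apply: contraFneq zS => eH; rewrite -(eqP ez) eH.
Qed.

(** The chain before the sink is handled for M2 by [chain_indep2], and the sink is added by
    [indep_add_transfer]. *)
Lemma chain_sink ch h : tight_chain ch h -> sink (ch h) ->
  (forall v, reach v -> sink v ->
     D (ch h) <= D v /\ (D v = D (ch h) -> (h <= H v)%N)) ->
  common M1 M2 (symdiff S (chain_set ch h)).
Proof.
move=> cch /andP [tS M2t] tmin; have [c1 c2 c3] := cch.
have oh : ~~ odd h by rewrite -(mem_chain cch (leqnn h)).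
rewrite /common chain_indep1 //=.
case: h cch tS M2t tmin c1 c3 oh => [|h] cch tS M2t tmin c1 c3 oh.
  suff -> : symdiff S (chain_set ch 0) = ch 0%N |: S by [].
  apply/setP => z; rewrite !inE leqn0.
  have [->|ne] := eqVneq z (ch 0%N).
    by rewrite (c1 0%N (leqnn 0)).2 !eqxx tS.
  case Hz : (H z == 0)%N => //=; last by rewrite andbF orbF.
  by rewrite (eqP Hz) eq_sym (negPf ne) /= andbF orbF.
have cch' := tight_chainW (leqnSn h) cch.
have oh' : odd h by rewrite /= negbK in oh.
have [M2T cT] := chain_indep2 cch' oh'.
have -> : symdiff S (chain_set ch h.+1) = ch h.+1 |: symdiff S (chain_set ch h).
  apply/setP => z; rewrite !inE; have [->|ne] := eqVneq z (ch h.+1).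
    by rewrite (c1 h.+1 (leqnn _)).2 leqnn eqxx tS.
  have -> // : (H z <= h.+1)%N && (ch (H z) == z) = (H z <= h)%N && (ch (H z) == z).
  rewrite [(H z <= h.+1)%N]leq_eqVlt ltnS.
  by case: eqP => [->|//]; rewrite ltnn /= [LHS]eq_sym; apply/negbTE.
apply: (indep_add_transfer M2S M2T) => //.
move=> y; rewrite !inE => /andP [yS]; rewrite (negPf yS) andbF /= => yC.
have yC' : y \in chain_set ch h by rewrite inE.
have [i [lei ey Hi]] := chain_setP yC'.
have oi : ~~ odd i by rewrite -(mem_chain cch' lei) -ey.
have lti : (i < h)%N by rewrite ltn_neqAle lei andbT; apply: contraNneq oi => ->.
have lti' : (i < h.+1)%N by apply: ltnW.
(* If y were a sink as well, the arc from the last vertex to the successor of y would give D y <= D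
   (ch h.+1), so y would be a nearest sink with fewer arcs. *)
apply/negP => M2y; have sy : sink y by rewrite /sink yS.
have ry : reach y by rewrite ey; apply: (c1 i (ltnW lti')).1.
have [le1 le2] := tmin y ry sy.
have xS : ch i.+1 \in S by rewrite (mem_chain cch' lti).
have [rt _] := c1 h.+1 (leqnn _).
have et : edge (ch h.+1) (ch i.+1).
  rewrite /edge xS tS /=; apply: indep_sub M2t; apply: setUS.
  exact: subD1set.
have := dist_edge dist rt et; have [_ ->] := c3 i lti'; rewrite -ey lerD2r => le3.
have : D y = D (ch h.+1) by apply/le_anti; rewrite le1 le3.
by move/le2; rewrite Hi => /leq_trans/(_ lei); rewrite ltnn.
Qed.


(** * Labels and their relaxation *)

Definition upd A v (b : bool) : {set U} := if b then v |: A else A :\ v.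

Lemma in_upd A v b x : (x \in upd A v b) = if x == v then b else x \in A.
Proof. by rewrite /upd; case: b; rewrite !inE; case: eqP. Qed.

Lemma weight_upd A v : (v \in A) = (v \in S) ->
  weight w (upd A v (v \notin S)) = weight w A + gain v.
Proof.
rewrite /upd /gain; case vS: (v \in S) => /= vA; first by rewrite weightD1.
by rewrite weightU1 ?vA // addrC.
Qed.

(** The correction depends on v alone, so comparing the sets A \ v orders the labels of v
    themselves. *)
Lemma weight_label A v : (v \in A) = (v \notin S) ->
  weight w A = weight w (A :\ v) + (if v \in S then 0 else w v).
Proof.
case vS: (v \in S) => /= vA; last by rewrite weightD1 // subrK.
suff -> : A :\ v = A by rewrite addr0.
by apply/setP=> z; rewrite !inE; case: eqP => // ->; rewrite vA.
Qed.

(** A label of excess weight need not come from a shortest walk; only one that attains D v is known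
    to be the trace of a tight chain. *)
Definition label_sound t v A : Prop :=
  [/\ reach v, #|A| = (#|S| + (v \notin S))%N, (v \in A) = (v \notin S),
      common M1 M2 (A :\ v) & D v <= weight w A - weight w S /\
      (weight w A - weight w S = D v -> (H v <= t)%N /\
        exists ch, [/\ tight_chain ch (H v), ch (H v) = v &
                       A = symdiff S (chain_set ch (H v))])].

(* State of the label (A, r) of [v] after [t] relaxation phases; [r] tells    *)
(* whether the label has been set.                                            *)
Definition label_inv t v A (r : bool) : Prop :=
  (r -> label_sound t v A) /\
  (reach v -> (H v <= t)%N -> r /\ weight w A - weight w S = D v).

Definition candidate (A : U -> {set U}) (rc : U -> bool) v u : bool :=
  [&& (u \in S) != (v \in S), rc u, (v \in A u) == (v \in S), edge u v &
      common M1 M2 (A u :\ v)].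

(** An existing label gives way only to a strictly lighter one; this keeps hop numbers minimal. *)
Definition relaxed (A : U -> {set U}) (rc : U -> bool) v A' (r' : bool) : Prop :=
  ((A' = A v /\ r' = rc v) \/
   exists b, [/\ candidate A rc v b, r', A' = upd (A b) v (v \notin S) &
     rc v -> weight w (A b :\ v) < weight w (A v :\ v)]) /\
  forall u, candidate A rc v u ->
    r' /\ weight w (A' :\ v) <= weight w (A u :\ v).

Lemma tight_chain_extend ch u v : tight_chain ch (H u) -> ch (H u) = u ->
  edge u v -> reach v -> D v = D u + gain v -> H v = (H u).+1 ->
  let ch' i := if (i <= H u)%N then ch i else v in
  [/\ tight_chain ch' (H v), ch' (H v) = v &
      symdiff S (chain_set ch' (H v)) =
      upd (symdiff S (chain_set ch (H u))) v (v \notin S)].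
Proof.
move=> [c1 c2 c3] chu uv rv tuv Hv ch'.
have chv : ch' (H v) = v by rewrite /ch' Hv ltnn.
split=> //.
  split.
  - move=> i; rewrite Hv leq_eqVlt ltnS => /orP [/eqP ->|lei].
      by rewrite -Hv chv.
    by rewrite /ch' lei; apply: c1.
  - by rewrite /ch' leq0n.
  - move=> i; rewrite Hv ltnS leq_eqVlt => /orP [/eqP ->|lti].
      by rewrite /ch' leqnn ltnn chu.
    by rewrite /ch' (ltnW lti) lti; apply: c3.
have inC z : (z \in chain_set ch' (H v)) =
             (z == v) || ((z != v) && (z \in chain_set ch (H u))).
  rewrite !inE; have [->|ne] := eqVneq z v; first by rewrite chv leqnn eqxx.
  rewrite /ch' /= Hv leq_eqVlt ltnS; case: eqP => [->|_] //=.
    by rewrite ltnn eq_sym (negPf ne).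
  by case: (_ <= _)%N.
apply/setP => z; rewrite in_upd !in_setU !in_setD !inC.
by case: (eqVneq z v) => [->|ne] //=; rewrite andbT.
Qed.

(** Soundness passes through any chosen candidate. For hop number t.+1 the label is exact because
    the predecessor on a shortest walk has an exact label and is a candidate. *)
Lemma relaxed_label_inv t (A : U -> {set U}) rc v A' r' :
  (forall u, (u \in S) != (v \in S) -> label_inv t u (A u) (rc u)) ->
  label_inv t v (A v) (rc v) -> relaxed A rc v A' r' ->
  label_inv t.+1 v A' r'.
Proof.
move=> labu [sndv cmpv] [choice best].
have snd' : r' -> label_sound t.+1 v A'.
  case: choice => [[-> ->] rv|[b [cb _ -> lt]] _].
    have [h1 h2 h3 h4 [h5 h6]] := sndv rv; split=> //; split=> // /h6 [leH hch].
    by split=> //; apply: leqW.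
  have /and5P [bv rb /eqP vAb eb comb] := cb.
  have [hb1 hb2 hb3 hb4 [hb5 hb6]] := (labu b bv).1 rb.
  have wA := weight_upd vAb.
  have inA : (v \in upd (A b) v (v \notin S)) = (v \notin S).
    by rewrite in_upd eqxx.
  have updD : upd (A b) v (v \notin S) :\ v = A b :\ v.
    by apply/setP=> z; rewrite in_setD1 in_upd !inE; case: eqP.
  have rv : reach v := reach_edge dist hb1 eb.
  have le1 := dist_edge dist hb1 eb.
  split=> //.
  - have [ubS vbS] := (edge_notin eb, vAb); rewrite ubS negbK in hb2.
    rewrite /upd; move: vbS hb2; case: (v \in S) => /= vAb' hb2.
      by have := cardsD1 v (A b); rewrite vAb' hb2; clear; lia.
    by rewrite cardsU1 vAb' hb2; clear; lia.
  - by rewrite updD.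
  rewrite wA; split; first by lra.
  move=> eD.
  have eb0 : weight w (A b) - weight w S = D b by lra.
  have tight : D v = D b + gain v by lra.
  have [leHb [ch [cch chb eA]]] := hb6 eb0.
  have leHv := hops_edge dist hb1 eb tight.
  (* If H v were at most H b, the previous label of v would already be exact, against strict
     improvement. *)
  have Hv : H v = (H b).+1.
    apply/eqP; rewrite eqn_leq leHv ltnNge; apply/negP => leHvb.
    have [rcv wv] := cmpv rv (leq_trans leHvb leHb).
    have [_ _ vAv _ _] := sndv rcv.
    have := weight_label vAv; have := weight_label inA.
    by rewrite updD wA => e1 e2; have := lt rcv; lra.
  split; first by rewrite Hv ltnS.
  have [cch' chv eA'] := tight_chain_extend cch chb eb rv tight Hv.
  by eexists; split; [exact: cch' | exact: chv | rewrite eA' -eA].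
split=> // rv leHv.
have [leHt|ltHt] := leqP (H v) t.
  have [rcv wv] := cmpv rv leHt.
  case: choice => [[-> ->]//|[b [cb rr eA lt]]]; split=> //.
  have [_ _ vA' _ [leD _]] := snd' rr.
  have [_ _ vAv _ _] := sndv rcv.
  have updD : A' :\ v = A b :\ v.
    by rewrite eA; apply/setP=> z; rewrite in_setD1 in_upd !inE; case: eqP.
  have := weight_label vAv; have := weight_label vA'; rewrite updD.
  by have := lt rcv; lra.
have Hv : H v = t.+1 by apply/eqP; rewrite eqn_leq leHv.
have [u [ru uv Hu tight]] := hopsS dist rv Hv.
have nuv : (u \in S) != (v \in S) by rewrite (edge_notin uv); case: (v \in S).
have [sndu cmpu] := labu u nuv.
have leHu : (H u <= t)%N by rewrite Hu.
have [rcu wu] := cmpu ru leHu.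
have [_ cAu uAu comu [_ /(_ wu) [_ [ch [cch chu eA]]]]] := sndu rcu.
have Hv' : H v = (H u).+1 by rewrite Hv Hu.
have [cch' chv eA'] := tight_chain_extend cch chu uv rv tight Hv'.
have vAu : (v \in A u) = (v \in S).
  have vC : (v \in chain_set ch (H u)) = false by rewrite inE Hv' ltnn.
  by rewrite eA in_setU !in_setD vC /= andbF orbF.
(* If v is in S, the extended chain is common independent by [chain_common]. Otherwise the chain of
   u ends in S, and A u \ v = A u. *)
have cu : candidate A rc v u.
  rewrite /candidate nuv rcu vAu eqxx uv /=.
  have [vS|vS] := boolP (v \in S).
    have := chain_common cch'; rewrite odd_hops // vS eA' -eA vS => /(_ isT).
    by rewrite /upd.
  have := chain_common cch; rewrite odd_hops // (edge_notin uv) vS -eA => /(_ isT).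
  suff -> : A u :\ v = A u by [].
  apply/setP=> z; rewrite !inE; case: eqP => // ->.
  by rewrite vAu (negPf vS).
have [rr leA] := best u cu; split=> //.
have [_ _ vA' _ [leD _]] := snd' rr.
have := weight_label vA'; have := weight_upd vAu.
have inA : (v \in upd (A u) v (v \notin S)) = (v \notin S).
  by rewrite in_upd eqxx.
have updD : upd (A u) v (v \notin S) :\ v = A u :\ v.
  by apply/setP=> z; rewrite in_setD1 in_upd !inE; case: eqP.
by have := weight_label inA; rewrite updD; lra.
Qed.

Lemma init_label_inv v A : (source v -> A = v |: S) -> label_inv 0 v A (source v).
Proof.
move=> eA; split=> [sv|rv]; last first.
  rewrite leqn0 => /eqP Hv; have [sv Dv] := hops0 dist rv Hv; split=> //.
  have vS : v \notin S by case/andP: sv.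
  by rewrite (eA sv) weightU1 // addrK Dv gain_notin.
rewrite (eA sv); have vS : v \notin S by case/andP: sv.
have rv := reach_src dist sv.
split=> //.
- by rewrite cardsU1 addnC.
- by rewrite setU11 vS.
- by rewrite setU1K // /common M1S M2S.
rewrite weightU1 // addrK -(gain_notin vS); split; first exact: (dist_src dist sv).
move=> Dv; have Hv := hops_src dist sv (esym Dv); rewrite Hv; split=> //.
exists (fun=> v); split=> //.
  by split=> // i; rewrite ?leqn0 // => /eqP ->.
apply/setP => z; rewrite !inE leqn0 [v == z]eq_sym.
have [->|ne] := eqVneq z v; first by rewrite Hv /= vS.
by rewrite !andbF orbF.
Qed.

(* A vertex outside its phase cannot have hop count [t.+1], by parity. *)
Lemma label_inv_next t v A r : odd t.+1 != (v \in S) -> label_inv t v A r ->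
  label_inv t.+1 v A r.
Proof.
move=> par [snd cmp]; split=> [rr|rv le].
  have [h1 h2 h3 h4 [h5 h6]] := snd rr; split=> //; split=> // /h6 [leH hch].
  by split=> //; apply: leqW.
apply: cmp => //; move: le; rewrite leq_eqVlt ltnS => /orP [/eqP Hv|//].
by move: par; rewrite -Hv odd_hops // eqxx.
Qed.

(** Among the nearest sinks take one with fewest arcs: hop numbers are below n, so its label is
    exact, and [chain_sink] applies. *)
Lemma sink_label t (A : U -> {set U}) (rc : U -> bool) :
  (forall v, label_inv t v (A v) (rc v)) -> (#|U| <= t.+1)%N ->
  (exists2 v, reach v & sink v) ->
  exists v, [/\ reach v, sink v,
    forall v', reach v' -> sink v' -> D v <= D v',
    rc v & common M1 M2 (A v) /\ weight w (A v) = weight w S + D v].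
Proof.
move=> lab leU [v0 rv0 sv0].
have v0J : [set v | reach v & sink v] != set0.
  by apply/set0Pn; exists v0; rewrite inE rv0.
have [v] := exists_lex_max (fun v => - D v) (fun v => #|U| - H v)%N v0J.
rewrite inE => /andP [rv sv] vmax; exists v.
have ltv := hops_lt dist rv.
have minv v' : reach v' -> sink v' -> D v <= D v' /\ (D v' = D v -> (H v <= H v')%N).
  move=> rv' sv'; have v'J : v' \in [set v | reach v & sink v] by rewrite inE rv'.
  have [le1 le2] := vmax v' v'J; split; first by rewrite -lerN2.
  move=> e; have := le2 (congr1 -%R e); have := hops_lt dist rv'.
  by move: ltv; clear; lia.
have leHt : (H v <= t)%N by rewrite -ltnS; apply: leq_trans leU.
have [snd cmp] := lab v; have [rcv wv] := cmp rv leHt.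
have [_ _ _ _ [_ /(_ wv) [_ [ch [cch chv eA]]]]] := snd rcv.
split=> //; first by move=> v' rv' sv'; have [] := minv v' rv' sv'.
split; last by rewrite -wv addrC subrK.
rewrite eA; apply: chain_sink => //; first by rewrite chv.
by move=> v' rv' sv'; rewrite chv; apply: minv.
Qed.

(* Compare T and S inside and outside the set of reachable elements. *)
Lemma no_augmenting_path : (forall v, reach v -> ~~ sink v) ->
  forall T, common M1 M2 T -> (#|T| <= #|S|)%N.
Proof.
move=> nosink T /andP [M1T M2T]; pose Q := [set v | reach v].
rewrite -(cardsID Q T) -(cardsID Q S); apply: leq_add.
  (* Reachable part, by M2: a surplus y of T would be a reachable sink or have an arc to an
     unreachable element of S. *)
  rewrite leqNgt; apply/negP => lt.
  have [||y] := @indep_aug _ M2 (S :&: Q) (T :&: Q) _ _ lt.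
  - by apply: indep_sub M2S; apply: subsetIl.
  - by apply: indep_sub M2T; apply: subsetIl.
  rewrite !inE => /andP [/nandP yn /andP [yT ry]] M2y.
  have yS : y \notin S by case: yn => //; rewrite ry.
  case: (indep_extend_exchange M2S yS (subsetIl _ _) M2y) => [M2yS|[x]].
    by have := nosink y ry; rewrite /sink yS M2yS.
  rewrite !inE => /andP [/nandP xn xS] M2x.
  have exy : edge y x by rewrite /edge xS yS.
  by case: xn => [/negP|/negP] //; apply; apply: reach_edge dist _ _ ry exy.
(* Unreachable part, by M1: a surplus y of T would be a source or receive an arc from a reachable
   element of S. *)
rewrite leqNgt; apply/negP => lt.
have [||y] := @indep_aug _ M1 (S :\: Q) (T :\: Q) _ _ lt.
- by apply: indep_sub M1S; apply: subsetDl.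
- by apply: indep_sub M1T; apply: subsetDl.
rewrite !inE => /andP [/nandP yn /andP [ry yT]] M1y.
have yS : y \notin S by case: yn => //; rewrite ry.
case: (indep_extend_exchange M1S yS (subsetDl _ _) M1y) => [M1yS|[x]].
  move/negP: ry; apply; apply: (reach_src dist); by rewrite /source yS.
rewrite !inE => /andP [/nandP xn xS] M1x.
have exy : edge x y by rewrite /edge (negPf yS) xS.
case: xn => [|/negP //]; rewrite negbK => rx.
by move/negP: ry; apply; apply: reach_edge dist _ _ rx exy.
Qed.

End Exchange.

(* Frank's weight splitting: a certificate that [S] has minimum weight among  *)
(* the common independent sets of its cardinality.                            *)
Definition split_optimal (R : realType) (U : finType) (M1 M2 : matroid U)
    (w : U -> R) (S : {set U}) : Prop :=
  exists w1 w2 : U -> R, [/\ forall v, (w1 v + w2 v = w v)%R,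
    min_weight_indep M1 w1 S & min_weight_indep M2 w2 S].

(** * Weight splittings and augmentation *)

Section Augment.
Local Open Scope ring_scope.
Variables (R : realType) (U : finType) (M1 M2 : matroid U) (w : U -> R).
Variable S : {set U}.
Implicit Types (u v x y z : U) (A C T : {set U}).

Lemma weight_split (w1 w2 : U -> R) : (forall v, w1 v + w2 v = w v) ->
  forall T, weight w T = weight w1 T + weight w2 T.
Proof.
by move=> sp T; rewrite /weight -big_split; apply: eq_bigr => v _; rewrite /= sp.
Qed.

Lemma split_optimal_set0 : split_optimal M1 M2 w set0.
Proof.
exists w, (fun=> 0); split; first by move=> v; rewrite addr0.
  by split=> [|T _]; [exact: indep_set0 | rewrite cards0 => /cards0_eq ->].
by split=> [|T _]; [exact: indep_set0 | rewrite cards0 => /cards0_eq ->].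
Qed.

Lemma split_optimal_min T : split_optimal M1 M2 w S -> common M1 M2 T ->
  #|T| = #|S| -> weight w S <= weight w T.
Proof.
move=> [w1 [w2 [sp [_ min1] [_ min2]]]] /andP [M1T M2T] cT.
by rewrite !(weight_split sp) lerD ?min1 ?min2.
Qed.

Lemma exchange_weight_le (M : matroid U) (w' : U -> R) x y :
  min_weight_indep M w' S -> x \in S -> y \notin S -> M (y |: (S :\ x)) ->
  w' x <= w' y.
Proof.
move=> [_ minS] xS yS My.
have ySx : y \notin S :\ x by rewrite !inE (negPf yS) andbF.
have := minS _ My; rewrite cardsU1 ySx [#|S|](cardsD1 x) xS => /(_ erefl).
by rewrite weightU1 // weightD1 //; lra.
Qed.

(** Turns the certificate into a potential, which rules out closed walks of negative cost. *)
Lemma split_potential (w1 w2 : U -> R) : (forall v, w1 v + w2 v = w v) ->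
  min_weight_indep M1 w1 S -> min_weight_indep M2 w2 S ->
  let q v := if v \in S then - w1 v else w2 v in
  forall u v, edge M1 M2 S u v -> q v - q u <= gain w S v.
Proof.
move=> sp min1 min2 q u v; rewrite /edge /gain /q.
have := sp v; have := sp u; case: (boolP (v \in S)) => vS su sv /andP [uS Mu].
  by rewrite (negPf uS); have := exchange_weight_le min2 vS uS Mu; lra.
by rewrite uS; have := exchange_weight_le min1 uS vS Mu; lra.
Qed.

(** For the splitting given by the distances, the lower bounds in M1 and in M2 on sets of size |S| +
    1 add up to w(S) + D t. Weighing no more than that, A attains both. *)
Lemma augment_split_optimal (reach : pred U) (D : U -> R) (H : U -> nat) t A :
  split_optimal M1 M2 w S ->
  distances (edge M1 M2 S) (source M1 S) (gain w S) reach D H ->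
  (forall v, reach v -> sink M2 S v -> D t <= D v) ->
  common M1 M2 A -> #|A| = #|S|.+1 -> weight w A <= weight w S + D t ->
  split_optimal M1 M2 w A.
Proof.
move=> [w1 [w2 [sp min1 min2]]] dist tmin /andP [M1A M2A] cA leA.
have pot := split_potential sp min1 min2.
move: pot; set q := fun v => _; move=> /= pot.
pose g u v : R := `|D v - q u - gain w S v| + `|D v - q u|.
pose B : R := \sum_u \sum_v g u v.
have Bge u v : g u v <= B.
  have g0 a b : 0 <= g a b by rewrite addr_ge0.
  rewrite /B (bigD1 u) //= (bigD1 v) //= -addrA lerDl addr_ge0 ?sumr_ge0 //.
  by move=> i _; apply: sumr_ge0.
(* [B] is so large that unreachable vertices impose no constraint *)
pose D' v := if reach v then D v else B + q v.
have D'src v : source M1 S v -> D' v <= gain w S v.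
  by move=> sv; rewrite /D' (reach_src dist sv); apply: dist_src dist _ sv.
have D'edge u v : edge M1 M2 S u v -> D' v <= D' u + gain w S v.
  move=> uv; rewrite /D'; case: (boolP (reach u)) => ru.
    by rewrite (reach_edge dist ru uv); apply: dist_edge dist _ _ ru uv.
  case: (boolP (reach v)) => rv; last by have := pot u v uv; lra.
  have := Bge u v; rewrite /g; have := ler_norm (D v - q u - gain w S v).
  by have := normr_ge0 (D v - q u); lra.
have D'sink v : sink M2 S v -> D t <= D' v.
  rewrite /D' => sv; case: (boolP (reach v)) => rv; first exact: tmin.
  have := Bge v t; rewrite /g; have := ler_norm (D t - q v).
  by have := normr_ge0 (D t - q v - gain w S t); lra.
(* The arc inequalities for [D'] become local optimality of S for both parts; elements addable in M1
   have [w1'] at least 0, those addable in M2 have [w2'] at least D t. *)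
pose w1' v := if v \in S then - D' v else w v - D' v.
pose w2' v := if v \in S then w v + D' v else D' v.
have sp' v : w1' v + w2' v = w v by rewrite /w1' /w2'; case: ifP => _; lra.
have [[M1S _] [M2S _]] := (min1, min2).
have min1' : min_weight_indep M1 w1' S.
  apply: min_weight_indepP => // x y xS yS My.
  have : edge M1 M2 S x y by rewrite /edge (negPf yS) xS.
  by move/D'edge; rewrite gain_notin // /w1' xS (negPf yS); lra.
have min2' : min_weight_indep M2 w2' S.
  apply: min_weight_indepP => // x y xS yS My.
  have : edge M1 M2 S y x by rewrite /edge xS yS.
  by move/D'edge; rewrite gain_in // /w2' xS (negPf yS); lra.
have lb1 T : M1 T -> #|T| = #|S|.+1 -> weight w1' S + 0 <= weight w1' T.
  apply: min_weight_indep_succ min1' _ T => y yS My.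
  have := D'src y; rewrite /source yS My gain_notin // => /(_ isT).
  by rewrite /w1' (negPf yS); lra.
have lb2 T : M2 T -> #|T| = #|S|.+1 -> weight w2' S + D t <= weight w2' T.
  apply: min_weight_indep_succ min2' _ T => y yS My.
  by have := D'sink y; rewrite /sink yS My /w2' (negPf yS); apply.
exists w1', w2'; split=> //; split=> // T MT; rewrite cA => cT.
  have := lb1 T MT cT; have := lb2 A M2A cA.
  by move: leA; rewrite !(weight_split sp'); lra.
have := lb2 T MT cT; have := lb1 A M1A cA.
by move: leA; rewrite !(weight_split sp'); lra.
Qed.

End Augment.

(** * Running programs *)


Definition For (x : nat) (body : cmd) : cmd :=
  Seq (Assign x (Const 0))
      (While (Leq (Add (Var x) (Const 1)) (Var 0))
             (Seq body (Assign x (Add (Var x) (Const 1))))).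

(* Running time when every loop makes at most n iterations. *)
Fixpoint time_bound (n : nat) (c : cmd) : nat :=
  match c with
  | Skip => 1
  | Assign _ e => (esize e).+1
  | Put _ i e => (esize i + esize e).+1
  | Seq p1 p2 => time_bound n p1 + time_bound n p2
  | If e p1 p2 => (esize e).+1 + (time_bound n p1 + time_bound n p2)
  | While e p => (esize e).+1 * n.+1 + n * time_bound n p
  | Indep1 _ _ i | Indep2 _ _ i => (esize i).+1
  | Compare _ _ i _ j => (esize i + esize j).+1
  end.

Fixpoint loop_depth (c : cmd) : nat :=
  match c with
  | Seq p1 p2 | If _ p1 p2 => maxn (loop_depth p1) (loop_depth p2)
  | While _ p => (loop_depth p).+1
  | _ => 0
  end.

Fixpoint time_coef (c : cmd) : nat :=
  match c with
  | Seq p1 p2 => time_coef p1 + time_coef p2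
  | If e p1 p2 => (esize e).+1 + (time_coef p1 + time_coef p2)
  | While e p => (esize e).+1 * 2 + time_coef p
  | _ => time_bound 0 c
  end.

Lemma time_bound_poly n c : 0 < n ->
  time_bound n c <= time_coef c * n ^ loop_depth c.
Proof.
move=> n0; have pow d : 0 < n ^ d by rewrite expn_gt0 n0.
have powl d1 d2 : n ^ d1 <= n ^ maxn d1 d2.
  by rewrite leq_pexp2l // leq_maxl.
have powr d1 d2 : n ^ d2 <= n ^ maxn d1 d2.
  by rewrite leq_pexp2l // leq_maxr.
elim: c => [|x e|a i e|p1 IH1 p2 IH2|e p1 IH1 p2 IH2|e p IH|x a i|x a i|x a i b j] /=;
  rewrite ?expn0 ?muln1 //.
- have := powl (loop_depth p1) (loop_depth p2).
  have := powr (loop_depth p1) (loop_depth p2).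
  move: IH1 IH2; set d := n ^ maxn _ _; rewrite mulnDl => h1 h2 l2 l1.
  by apply: leq_add; [apply: leq_trans h1 _|apply: leq_trans h2 _];
    rewrite leq_mul2l ?l1 ?l2 orbT.
- have := powl (loop_depth p1) (loop_depth p2).
  have := powr (loop_depth p1) (loop_depth p2).
  have := pow (maxn (loop_depth p1) (loop_depth p2)).
  move: IH1 IH2; set d := n ^ maxn _ _; rewrite !mulnDl => h1 h2 d0 l2 l1.
  apply: leq_add; first by rewrite leq_pmulr.
  by apply: leq_add; [apply: leq_trans h1 _|apply: leq_trans h2 _];
    rewrite leq_mul2l ?l1 ?l2 orbT.
- rewrite mulnDl; apply: leq_add.
    rewrite -mulnA leq_mul2l /= expnS.
    have : n * 1 <= n * n ^ loop_depth p by rewrite leq_mul2l pow orbT.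
    by move: (n * n ^ _) => m; lia.
  by rewrite expnS mulnCA leq_mul2l IH orbT.
Qed.

Fixpoint mods (c : cmd) : seq nat :=
  match c with
  | Skip | Put _ _ _ => [::]
  | Assign x _ | Indep1 x _ _ | Indep2 x _ _ | Compare x _ _ _ _ => [:: x]
  | Seq p1 p2 | If _ p1 p2 => mods p1 ++ mods p2
  | While _ p => mods p
  end.

(** * Total-correctness rules with time bounds *)

Section Run.
Variables (R : realType) (U : finType) (M1 M2 : matroid U) (w : U -> R).
Variable W : nat.

Notation n := #|U|.
Notation exec := (@exec R U M1 M2 w W).

Lemma exec_queries_le p s q t s' : exec p s q t s' -> q <= t.
Proof. by elim=> *; lia. Qed.

Lemma exec_frame p s q t s' : exec p s q t s' ->
  forall x, x \notin mods p -> vars s' x = vars s x.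
Proof.
elim=> //=.
- by move=> x e s0 _ y; rewrite inE => /negPf ->.
- by move=> p1 p2 s0 s1 s2 q1 q2 t1 t2 _ IH1 _ IH2 x;
    rewrite mem_cat negb_or => /andP [/IH1 <- /IH2 ->].
- move=> e p1 p2 s0 s1 q0 t0 _ IH x; rewrite mem_cat negb_or => /andP [h1 h2].
  by apply: IH; case: ifP.
- by move=> e p0 s0 s1 s2 q1 q2 t1 t2 _ _ IH1 _ IH2 x xp; rewrite IH2 // IH1.
- by move=> x a i s0 y; rewrite inE => /negPf ->.
- by move=> x a i s0 y; rewrite inE => /negPf ->.
- by move=> x a i b j s0 _ _ y; rewrite inE => /negPf ->.
Qed.

Definition run (p : cmd) (s : store) (Q : store -> Prop) : Prop :=
  exists q t s', [/\ exec p s q t s', t <= time_bound n p & Q s'].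

Lemma run_mono p s (Q Q' : store -> Prop) :
  run p s Q -> (forall s', Q s' -> Q' s') -> run p s Q'.
Proof. by move=> [q [t [s' [ex le Qs]]]] QQ'; exists q, t, s'; split=> //; apply: QQ'. Qed.

Lemma run_frame p s Q : run p s Q ->
  run p s (fun s' => Q s' /\ forall x, x \notin mods p -> vars s' x = vars s x).
Proof.
move=> [q [t [s' [ex le Qs]]]]; exists q, t, s'; split=> //; split=> //.
exact: exec_frame ex.
Qed.

Lemma run_skip s (Q : store -> Prop) : Q s -> run Skip s Q.
Proof. by exists 0, 1, s; split=> //; constructor. Qed.

Lemma run_assign x e va ar (Q : store -> Prop) :
  eval (Store va ar) e < W ->
  Q (Store (fun y => if y == x then eval (Store va ar) e else va y) ar) ->
  run (Assign x e) (Store va ar) Q.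
Proof. by move=> lt Qs; do 3 eexists; split; [apply: ExecAssign|exact: leqnn|]. Qed.

Lemma run_put a i e va ar (Q : store -> Prop) :
  eval (Store va ar) i < W -> eval (Store va ar) e < W ->
  Q (set_arr (Store va ar) a (eval (Store va ar) i) (eval (Store va ar) e)) ->
  run (Put a i e) (Store va ar) Q.
Proof. by move=> lt lt2 Qs; do 3 eexists; split; [apply: ExecPut|exact: leqnn|]. Qed.

Lemma run_seq p1 p2 s Q :
  run p1 s (fun s1 => run p2 s1 Q) -> run (Seq p1 p2) s Q.
Proof.
move=> [q1 [t1 [s1 [ex1 le1 [q2 [t2 [s2 [ex2 le2 Qs]]]]]]]].
exists (q1 + q2), (t1 + t2), s2; split=> //; first exact: ExecSeq ex1 ex2.
exact: leq_add.
Qed.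

Lemma run_if_neq0 e p1 p2 s Q (b : bool) : (eval s e != 0) = b ->
  (b -> run p1 s Q) -> (~~ b -> run p2 s Q) -> run (If e p1 p2) s Q.
Proof.
move=> eb r1 r2; have : run (if eval s e != 0 then p1 else p2) s Q.
  by rewrite eb; case: b r1 r2 {eb} => [r1 _|_ r2]; [apply: r1|apply: r2].
move=> [q [t [s' [ex le Qs]]]]; exists q, ((esize e).+1 + t), s'; split=> //.
  exact: ExecIf.
rewrite /= leq_add2l; apply: leq_trans le _.
by case: ifP => _; rewrite ?leq_addr ?leq_addl.
Qed.

Lemma run_if e p1 p2 s Q (b : bool) : eval s e = b ->
  (b -> run p1 s Q) -> (~~ b -> run p2 s Q) -> run (If e p1 p2) s Q.
Proof. by move=> eb; apply: run_if_neq0; rewrite eb; case: b {eb}. Qed.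

Lemma run_ifN e p1 p2 s Q (b : bool) : eval s e = b ->
  (~~ b -> run p2 s Q) -> (b -> run p1 s Q) -> run (If e p1 p2) s Q.
Proof. by move=> eb r2 r1; apply: run_if eb r1 r2. Qed.

Lemma run_indep1 x a i va ar (Q : store -> Prop) T :
  set_at U (Store va ar) a (eval (Store va ar) i) = T ->
  Q (Store (fun y => if y == x then M1 T : nat else va y) ar) ->
  run (Indep1 x a i) (Store va ar) Q.
Proof. by move=> <- Qs; do 3 eexists; split; [apply: ExecIndep1|exact: leqnn|]. Qed.

Lemma run_indep2 x a i va ar (Q : store -> Prop) T :
  set_at U (Store va ar) a (eval (Store va ar) i) = T ->
  Q (Store (fun y => if y == x then M2 T : nat else va y) ar) ->
  run (Indep2 x a i) (Store va ar) Q.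
Proof. by move=> <- Qs; do 3 eexists; split; [apply: ExecIndep2|exact: leqnn|]. Qed.

Lemma run_compare x a i b j va ar (Q : store -> Prop) T T' :
  set_at U (Store va ar) a (eval (Store va ar) i) = T ->
  set_at U (Store va ar) b (eval (Store va ar) j) = T' ->
  common M1 M2 T -> common M1 M2 T' ->
  Q (Store (fun y => if y == x then compare_weights w T T' else va y) ar) ->
  run (Compare x a i b j) (Store va ar) Q.
Proof. by move=> <- <- c1 c2 Qs; do 3 eexists; split; [apply: ExecCompare|exact: leqnn|]. Qed.

Definition idx (u : U) : nat := enum_rank u.

Lemma idx_lt u : idx u < n. Proof. exact: ltn_ord. Qed.

Lemma idx_inj : injective idx.
Proof. by move=> u v /ord_inj /enum_rank_inj. Qed.

Hypothesis ltW : n < W.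

(** The invariant speaks of the set of elements already visited instead of the counter, which holds
    the rank of the next element. *)
Lemma run_for (x : nat) body (I : {set U} -> store -> Prop) s (Q : store -> Prop) :
  vars s 0 = n -> x != 0 -> x \notin mods body -> 0 \notin mods body ->
  I set0 (set_var s x 0) ->
  (forall (P : {set U}) u va ar, u \notin P -> I P (Store va ar) ->
     (forall y, y \notin x :: mods body -> va y = vars s y) -> va x = idx u ->
     run body (Store va ar) (fun s' => I (u |: P) (set_var s' x (idx u).+1))) ->
  (forall va ar, I setT (Store va ar) ->
     (forall y, y \notin x :: mods body -> va y = vars s y) -> Q (Store va ar)) ->
  run (For x body) s Q.
Proof.
move=> s0 x0 xb b0 I0 step fin.
have yn0 : 0 \notin x :: mods body by rewrite inE negb_or eq_sym x0.
set e := Leq (Add (Var x) (Const 1)) (Var 0).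
set p := Seq body (Assign x (Add (Var x) (Const 1))).
have loop k : forall i s1, i + k = n -> vars s1 x = i ->
    (forall y, y \notin x :: mods body -> vars s1 y = vars s y) ->
    I [set u | idx u < i] s1 ->
    exists q t s', [/\ exec (While e p) s1 q t s',
      t <= (esize e).+1 * k.+1 + k * time_bound n p & Q s'].
  elim: k => [|k IH] i [va ar] eik /= vx fr Is.
    exists 0, (esize e).+1, (Store va ar); split.
    - apply: ExecWhileEnd => /=; rewrite vx fr // s0; move: eik; rewrite addn0 => ->.
      by rewrite addn1 ltnn.
    - by rewrite muln1 leq_addr.
    apply: fin => //; congr (I _ _) : Is; apply/setP=> u; rewrite !inE.
    by move: eik; rewrite addn0 => ->; rewrite idx_lt.
  have lti : i < n by rewrite -eik -addSnnS leq_addr.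
  pose u := enum_val (Ordinal lti : 'I_#|U|).
  have iu : idx u = i by rewrite /idx /u enum_valK.
  have nu : u \notin [set u | idx u < i] by rewrite inE iu ltnn.
  have [q1 [t1 [s2 [ex1 le1 [Is2 fr2]]]]] :=
    run_frame (step _ u va ar nu Is fr (etrans vx (esym iu))).
  rewrite /= in fr2.
  have x2 : vars s2 x = i by rewrite fr2.
  have exa : exec (Assign x (Add (Var x) (Const 1))) s2 0 4
      (set_var s2 x (idx u).+1).
    have -> : (idx u).+1 = eval s2 (Add (Var x) (Const 1)).
      by rewrite /= x2 iu addn1.
    apply: ExecAssign; rewrite /= x2 addn1; exact: leq_ltn_trans lti ltW.
  have [||| |q2 [t2 [s3 [ex2 le2 Qs3]]]] := IH i.+1 (set_var s2 x (idx u).+1).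
  - by rewrite addSnnS.
  - by rewrite /= eqxx iu.
  - move=> y yn; move: (yn); rewrite inE negb_or => /andP [yx yb] /=.
    by rewrite (negPf yx) fr2 // fr.
  - congr (I _ _) : Is2; apply/setP=> v; rewrite !inE ltnS [in RHS]leq_eqVlt -iu.
    by rewrite (inj_eq idx_inj).
  exists (0 + (q1 + 0) + q2), ((esize e).+1 + (t1 + 4) + t2), s3; split=> //.
    apply: ExecWhileLoop ex2; last by apply: ExecSeq ex1 exa.
    by rewrite /= vx fr // s0 addn1 lti.
  have arith E T a b : a <= T -> b <= E * k.+1 + k * T ->
      E + a + b <= E * k.+2 + k.+1 * T.
    by rewrite mulnS [k.+1 * _]mulSn; move: (E * k.+1) (k * T) => c d; clear; lia.
  by apply: arith le2; rewrite leq_add2r.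
apply: run_seq; do 3 eexists; split; first exact: ExecAssign (leq_ltn_trans _ ltW).
  by [].
have [|||  |q [t [s' [ex le Qs]]]] := loop n 0 (set_var s x 0).
- by [].
- by rewrite /= eqxx.
- by move=> y; rewrite inE negb_or /= => /andP [/negPf -> _].
- by congr (I _ _) : I0; apply/setP=> u; rewrite !inE.
by exists q, t, s'.
Qed.

End Run.

(** * The algorithm *)


Definition Not (e : expr) : expr := Defs.Sub (Const 1) e.

Definition At (x y : nat) : expr := Add (Mul (Var 0) (Var x)) (Var y).

Definition Copy (a : nat) (i : expr) (b : nat) (j : expr) : cmd :=
  For 10 (Put a (Add i (Var 10)) (Get b (Add j (Var 10)))).

(* Array 0: best set so far.  Array 1: current set S.  Array 2: the label of  *)
(* the vertex v is the segment starting at n * v.  Array 3: labelled vertices.*)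
(* Variables: 3 and 4 are the head and tail of the arc being relaxed, 5 is    *)
(* the vertex holding the best label (if 6 is nonzero), 11 tells whether the  *)
(* head is in S.                                                              *)
Definition InitLabel : cmd :=
  Seq (Put 3 (Var 3) (Const 0))
  (If (Get 1 (Var 3)) Skip
    (Seq (Put 1 (Var 3) (Const 1))
    (Seq (Indep1 7 1 (Const 0))
    (Seq (Put 1 (Var 3) (Const 0))
    (If (Var 7)
      (Seq (Put 3 (Var 3) (Const 1))
      (Seq (Copy 2 (Mul (Var 0) (Var 3)) 1 (Const 0))
           (Put 2 (At 3 3) (Const 1))))
      Skip))))).

(* The sets to be tested and compared differ from the stored ones by at most  *)
(* two elements.  Editing the arrays and undoing the edits makes the cost of  *)
(* an arc constant; copying would cost n.                                     *)
Definition RelaxArc : cmd :=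
  If (Mul (Mul (Eq (Get 1 (Var 4)) (Not (Var 11))) (Get 3 (Var 4)))
          (Eq (Get 2 (At 4 3)) (Var 11)))
    (Seq (Put 1 (Var 4) (Var 11))
    (Seq (Put 1 (Var 3) (Not (Var 11)))
    (Seq (Indep1 7 1 (Const 0))
    (Seq (Indep2 8 1 (Const 0))
    (Seq (Put 1 (Var 4) (Not (Var 11)))
    (Seq (Put 1 (Var 3) (Var 11))
    (If (Add (Mul (Var 11) (Var 8)) (Mul (Not (Var 11)) (Var 7)))
      (Seq (Put 2 (At 4 3) (Const 0))
      (Seq (Indep1 7 2 (Mul (Var 0) (Var 4)))
      (Seq (Indep2 8 2 (Mul (Var 0) (Var 4)))
      (Seq
        (If (Mul (Var 7) (Var 8))
          (If (Var 6)
            (Seq (Assign 12 (Get 2 (At 5 3)))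
            (Seq (Put 2 (At 5 3) (Const 0))
            (Seq (Compare 9 2 (Mul (Var 0) (Var 4)) 2 (Mul (Var 0) (Var 5)))
            (Seq (Put 2 (At 5 3) (Var 12))
                 (If (Var 9) Skip (Assign 5 (Var 4)))))))
            (Seq (Assign 5 (Var 4)) (Assign 6 (Const 1))))
          Skip)
        (Put 2 (At 4 3) (Var 11))))))
      Skip)))))))
    Skip.

(** Variables 5 and 6 start with the present label of v, which thus competes with the candidates and
    survives ties. Copying happens once per vertex, after the scan. *)
Definition Relax : cmd :=
  Seq (Assign 11 (Get 1 (Var 3)))
  (Seq (Assign 5 (Var 3))
  (Seq (Assign 6 (Get 3 (Var 3)))
  (Seq (For 4 RelaxArc)
  (If (Var 6)
    (Seq (Put 3 (Var 3) (Const 1))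
    (Seq (Copy 2 (Mul (Var 0) (Var 3)) 2 (Mul (Var 0) (Var 5)))
         (Put 2 (At 3 3) (Not (Var 11)))))
    Skip)))).

(** Arcs join S to its complement and a pass writes labels of one side only, so updating in place is
    synchronous. *)
Definition Pass (phase : nat) : cmd :=
  For 3 (If (Eq (Get 1 (Var 3)) (Const phase)) Relax Skip).

Definition PickLabel : cmd :=
  If (Mul (Not (Get 1 (Var 3))) (Get 3 (Var 3)))
    (Seq (Indep1 7 2 (Mul (Var 0) (Var 3)))
    (Seq (Indep2 8 2 (Mul (Var 0) (Var 3)))
    (If (Mul (Var 7) (Var 8))
      (If (Var 6)
        (Seq (Compare 9 2 (Mul (Var 0) (Var 3)) 2 (Mul (Var 0) (Var 5)))
             (If (Var 9) Skip (Assign 5 (Var 3))))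
        (Seq (Assign 5 (Var 3)) (Assign 6 (Const 1))))
      Skip)))
    Skip.

Definition Update : cmd :=
  If (Var 6)
    (Seq (Copy 1 (Const 0) 2 (Mul (Var 0) (Var 5)))
    (Seq (Compare 9 1 (Const 0) 0 (Const 0))
         (If (Var 9) Skip (Copy 0 (Const 0) 1 (Const 0)))))
    Skip.

Definition Augment : cmd :=
  Seq (For 3 InitLabel)
  (Seq (For 2 (Seq (Pass 1) (Pass 0)))
  (Seq (Assign 6 (Const 0))
  (Seq (For 3 PickLabel)
       Update))).

Definition matroid_intersection : cmd := For 1 Augment.

(** * Array representation and correctness of the subprograms *)

Section Program.
Variables (R : realType) (U : finType) (M1 M2 : matroid U) (w : U -> R).
Variable W : nat.

Notation n := #|U|.
Notation run := (@run R U M1 M2 w W).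

Hypothesis hW : n * n + n + 2 < W.

Lemma n_lt_W : n < W.
Proof. by move: hW; move: (n * n) => m; lia. Qed.

Lemma small_lt_W k : k <= 1 -> k < W.
Proof. by move: hW; move: (n * n) => m; lia. Qed.

Lemma idx_lt_W (u : U) : idx u < W.
Proof. exact: ltn_trans (idx_lt u) n_lt_W. Qed.

Lemma pair_lt_W (v u : U) : n * idx v + idx u < W.
Proof.
have : n * (idx v).+1 <= n * n by rewrite leq_mul2l (idx_lt v) orbT.
have := idx_lt u; move: hW; rewrite mulnS; move: (n * n) (n * idx v) => a b.
by lia.
Qed.

Lemma pair_inj (v u v' u' : U) :
  n * idx v + idx u = n * idx v' + idx u' -> v = v' /\ u = u'.
Proof.
move=> e; have n0 : 0 < n by apply: leq_ltn_trans (idx_lt u).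
have ev : idx v = idx v'.
  have := congr1 (divn^~ n) e.
  by rewrite ![n * _]mulnC !divnMDl // !divn_small ?addn0 ?idx_lt.
split; apply: idx_inj => //.
by apply/eqP; rewrite -(eqn_add2l (n * idx v)) {2}ev e.
Qed.

Definition fupd (T : Type) (f : U -> T) v x := fun v' => if v' == v then x else f v'.

Record represents (ar : nat -> nat -> nat) (B S : {set U}) (A : U -> {set U})
    (rc : U -> bool) : Prop := Represents {
  rep0 : forall u, ar 0 (idx u) = (u \in B);
  rep1 : forall u, ar 1 (idx u) = (u \in S);
  rep2 : forall v u, ar 2 (n * idx v + idx u) = (u \in A v);
  rep3 : forall v, ar 3 (idx v) = rc v }.

Implicit Types (B S T : {set U}) (A : U -> {set U}) (rc : U -> bool).
Implicit Types (va : nat -> nat) (ar : nat -> nat -> nat) (u v b : U).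

Lemma represents_ext ar B S A rc S' A' rc' : represents ar B S A rc ->
  S =i S' -> (forall v, A v = A' v) -> rc =1 rc' -> represents ar B S' A' rc'.
Proof.
move=> [r0 r1 r2 r3] eS eA erc; split=> //.
- by move=> u; rewrite r1 eS.
- by move=> v u; rewrite r2 eA.
- by move=> v; rewrite r3 erc.
Qed.

Lemma set_at0 va ar B S A rc : represents ar B S A rc ->
  set_at U (Store va ar) 0 0 = B.
Proof.
by move=> r; apply/setP=> u; rewrite inE add0n /= -/(idx u) (rep0 r); case: (_ \in _).
Qed.

Lemma set_at1 va ar B S A rc : represents ar B S A rc ->
  set_at U (Store va ar) 1 0 = S.
Proof.
by move=> r; apply/setP=> u; rewrite inE add0n /= -/(idx u) (rep1 r); case: (_ \in _).
Qed.

Lemma set_at2 va ar B S A rc v : represents ar B S A rc ->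
  set_at U (Store va ar) 2 (n * idx v) = A v.
Proof.
by move=> r; apply/setP=> u; rewrite inE /= -/(idx u) (rep2 r); case: (_ \in _).
Qed.

Lemma run_put1 i e va ar B S A rc u (c : bool) (Q : store -> Prop) :
  represents ar B S A rc -> eval (Store va ar) i = idx u ->
  eval (Store va ar) e = c ->
  (forall ar', represents ar' B (upd S u c) A rc -> Q (Store va ar')) ->
  run (Put 1 i e) (Store va ar) Q.
Proof.
move=> r ei ee fin; apply: run_put; rewrite ?ei ?ee ?idx_lt_W ?small_lt_W ?leq_b1 //.
apply: fin; split=> /= [x|x|v x|v].
- exact: rep0 r x.
- by rewrite (inj_eq (@idx_inj U)) in_upd; case: eqP => // _; apply: rep1 r x.
- exact: rep2 r v x.
- exact: rep3 r v.
Qed.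

Lemma run_put2 i e va ar B S A rc v u (c : bool) (Q : store -> Prop) :
  represents ar B S A rc -> eval (Store va ar) i = n * idx v + idx u ->
  eval (Store va ar) e = c ->
  (forall ar', represents ar' B S (fupd A v (upd (A v) u c)) rc ->
     Q (Store va ar')) ->
  run (Put 2 i e) (Store va ar) Q.
Proof.
move=> r ei ee fin; apply: run_put; rewrite ?ei ?ee ?pair_lt_W ?small_lt_W ?leq_b1 //.
apply: fin; split=> /= [x|x|v' x|v'].
- exact: rep0 r x.
- exact: rep1 r x.
- rewrite /fupd; case: eqP => [/pair_inj [-> ->]|ne]; first by rewrite eqxx in_upd eqxx.
  rewrite (rep2 r); case: eqP => // ev; rewrite in_upd; case: eqP => [ex|]; last by rewrite ev.
  by rewrite ev ex in ne.
- exact: rep3 r v'.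
Qed.

Lemma run_put3 i e va ar B S A rc u (c : bool) (Q : store -> Prop) :
  represents ar B S A rc -> eval (Store va ar) i = idx u ->
  eval (Store va ar) e = c ->
  (forall ar', represents ar' B S A (fupd rc u c) -> Q (Store va ar')) ->
  run (Put 3 i e) (Store va ar) Q.
Proof.
move=> r ei ee fin; apply: run_put; rewrite ?ei ?ee ?idx_lt_W ?small_lt_W ?leq_b1 //.
apply: fin; split=> /= [x|x|v x|v].
- exact: rep0 r x.
- exact: rep1 r x.
- exact: rep2 r v x.
- by rewrite (inj_eq (@idx_inj U)) /fupd; case: eqP => // _; apply: rep3 r v.
Qed.

(** The addresses must not depend on the loop variable 10. Source and target may coincide, as
    happens when a vertex keeps its own label. *)
Lemma run_copy (a : nat) i (b : nat) j va ar ki kj (Q : store -> Prop) :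
  va 0 = n ->
  (forall va' ar', (forall y, y != 10 -> va' y = va y) ->
     eval (Store va' ar') i = ki /\ eval (Store va' ar') j = kj) ->
  (forall u, ki + idx u < W) -> (forall u, ar b (kj + idx u) <= 1) ->
  (a = b /\ ki = kj) \/
    (forall u u', ((b == a) && (kj + idx u == ki + idx u')) = false) ->
  (forall va' ar', (forall y, y != 10 -> va' y = va y) ->
     (forall u, ar' a (ki + idx u) = ar b (kj + idx u)) ->
     (forall c k, (forall u, ((c == a) && (k == ki + idx u)) = false) ->
        ar' c k = ar c k) -> Q (Store va' ar')) ->
  run (Copy a i b j) (Store va ar) Q.
Proof.
move=> h0 evij ltk le1 disj fin.
pose I (P : {set U}) (s : store) :=
  (forall u, u \in P -> arrs s a (ki + idx u) = ar b (kj + idx u)) /\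
  (forall c k, (forall u, u \in P -> ((c == a) && (k == ki + idx u)) = false) ->
        arrs s c k = ar c k).
apply: (run_for n_lt_W (I := I)) => //.
- by split=> // u; rewrite inE.
- move=> P u va' ar' uP [i1 i2] fr v10.
  have fr' y : y != 10 -> va' y = va y.
    by move=> y10; apply: fr; rewrite inE.
  have [ei ej] := evij va' ar' fr'.
  have src : ar' b (kj + idx u) = ar b (kj + idx u).
    apply: i2 => u' u'P; case: disj => [[-> ->]|-> //].
    rewrite eqn_add2l (inj_eq (@idx_inj U)) eqxx /=.
    by apply: contraNF uP => /eqP ->.
  apply: run_put; rewrite /= ?ei ?ej ?v10 ?src ?ltk ?small_lt_W //.
  split=> /=.
    move=> u'; rewrite !inE eqxx eqn_add2l (inj_eq (@idx_inj U)) /=.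
    by case: eqP => [->//|_ /= u'P]; apply: i1.
  move=> c k ne; rewrite ne ?setU11 //; apply: i2 => u' u'P; apply: ne.
  by rewrite inE u'P orbT.
- move=> va' ar' [i1 i2] fr; apply: fin.
  + by move=> y y10; apply: fr; rewrite inE.
  + by move=> u; apply: i1.
  + by move=> c k ne; apply: i2.
Qed.

Lemma run_copy_best va ar B S A rc (Q : store -> Prop) : va 0 = n ->
  represents ar B S A rc ->
  (forall va' ar', (forall y, y != 10 -> va' y = va y) ->
     represents ar' S S A rc -> Q (Store va' ar')) ->
  run (Copy 0 (Const 0) 1 (Const 0)) (Store va ar) Q.
Proof.
move=> h0 r fin; apply: (run_copy (ki := 0) (kj := 0)) => //.
- by move=> u; apply: idx_lt_W.
- by move=> u; rewrite (rep1 r) leq_b1.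
- by right.
move=> va' ar' fr h1 h2; apply: fin => //; split=> [u|u|v u|v].
- by rewrite (h1 u) (rep1 r).
- by rewrite h2 // (rep1 r).
- by rewrite h2 // (rep2 r).
- by rewrite h2 // (rep3 r).
Qed.

Lemma run_copy_current va ar B S A rc b (Q : store -> Prop) : va 0 = n ->
  va 5 = idx b -> represents ar B S A rc ->
  (forall va' ar', (forall y, y != 10 -> va' y = va y) ->
     represents ar' B (A b) A rc -> Q (Store va' ar')) ->
  run (Copy 1 (Const 0) 2 (Mul (Var 0) (Var 5))) (Store va ar) Q.
Proof.
move=> h0 h5 r fin; apply: (run_copy (ki := 0) (kj := n * idx b)) => //.
- by move=> va' ar' fr; rewrite /= !fr // h0 h5.
- by move=> u; apply: idx_lt_W.
- by move=> u; rewrite (rep2 r) leq_b1.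
- by right.
move=> va' ar' fr h1 h2; apply: fin => //; split=> [u|u|v u|v].
- by rewrite h2 // (rep0 r).
- by rewrite (h1 u) (rep2 r).
- by rewrite h2 // (rep2 r).
- by rewrite h2 // (rep3 r).
Qed.

Lemma represents_copy2 ar ar' B S A rc v T : represents ar B S A rc ->
  (forall u, ar' 2 (n * idx v + idx u) = (u \in T)) ->
  (forall c k, (forall u, ((c == 2) && (k == n * idx v + idx u)) = false) ->
        ar' c k = ar c k) ->
  represents ar' B S (fupd A v T) rc.
Proof.
move=> r h1 h2; split=> [u|u|v' u|v'].
- by rewrite h2 // (rep0 r).
- by rewrite h2 // (rep1 r).
- rewrite /fupd; case: eqP => [->|ne]; first exact: h1.
  by rewrite h2 ?(rep2 r) // => u'; apply/negP => /eqP /pair_inj [].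
- by rewrite h2 // (rep3 r).
Qed.

Lemma run_copy_label_current va ar B S A rc v (Q : store -> Prop) : va 0 = n ->
  va 3 = idx v -> represents ar B S A rc ->
  (forall va' ar', (forall y, y != 10 -> va' y = va y) ->
     represents ar' B S (fupd A v S) rc -> Q (Store va' ar')) ->
  run (Copy 2 (Mul (Var 0) (Var 3)) 1 (Const 0)) (Store va ar) Q.
Proof.
move=> h0 h3 r fin; apply: (run_copy (ki := n * idx v) (kj := 0)) => //.
- by move=> va' ar' fr; rewrite /= !fr // h0 h3.
- by move=> u; apply: pair_lt_W.
- by move=> u; rewrite (rep1 r) leq_b1.
- by right.
move=> va' ar' fr h1 h2; apply: fin => //; apply: (represents_copy2 r _ h2).
by move=> u; rewrite h1 (rep1 r).
Qed.

Lemma run_copy_label va ar B S A rc v b (Q : store -> Prop) : va 0 = n ->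
  va 3 = idx v -> va 5 = idx b -> represents ar B S A rc ->
  (forall va' ar', (forall y, y != 10 -> va' y = va y) ->
     represents ar' B S (fupd A v (A b)) rc -> Q (Store va' ar')) ->
  run (Copy 2 (Mul (Var 0) (Var 3)) 2 (Mul (Var 0) (Var 5))) (Store va ar) Q.
Proof.
move=> h0 h3 h5 r fin.
apply: (run_copy (ki := n * idx v) (kj := n * idx b)) => //.
- by move=> va' ar' fr; rewrite /= !fr // h0 h3 h5.
- by move=> u; apply: pair_lt_W.
- by move=> u; rewrite (rep2 r) leq_b1.
- have [->|ne] := eqVneq v b; [by left|right] => u u' /=.
  by apply/negP => /eqP /pair_inj [e _]; rewrite e eqxx in ne.
move=> va' ar' fr h1 h2; apply: fin => //; apply: (represents_copy2 r _ h2).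
by move=> u; rewrite h1 (rep2 r).
Qed.

Lemma run_init_label va ar B S A rc v : va 0 = n -> va 3 = idx v ->
  represents ar B S A rc ->
  run InitLabel (Store va ar) (fun s => exists A' rc',
    [/\ represents (arrs s) B S A' rc', rc' v = source M1 S v,
        source M1 S v -> A' v = v |: S &
        forall v', v' != v -> A' v' = A v' /\ rc' v' = rc v']).
Proof.
move=> h0 h3 r; rewrite /InitLabel.
apply: run_seq; apply: (run_put3 (u := v) (c := false) r) => //= ar0 r0.
apply: (run_if (b := v \in S)) => [|vS|vS].
- by rewrite /= h3 (rep1 r0).
- apply: run_skip; exists A, (fupd rc v false); split=> //.
  + by rewrite /fupd eqxx /source vS.
  + by rewrite /source vS.
  + by move=> v' /negPf ne; rewrite /fupd ne.
apply: run_seq; apply: (run_put1 (u := v) (c := true) r0) => // ar1 r1.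
apply: run_seq; apply: run_indep1; first exact: set_at1 r1.
apply: run_seq; apply: (run_put1 (u := v) (c := false) r1) => // ar2 r2'.
have r2 : represents ar2 B S A (fupd rc v false).
  apply: represents_ext r2' _ _ _ => // x; rewrite !in_upd.
  by case: eqP => // ->; rewrite (negPf vS).
have sE : source M1 S v = M1 (upd S v true) by rewrite /source vS.
apply: (run_if (b := source M1 S v)) => [|sv|sv]; first by rewrite /= sE.
  apply: run_seq; apply: (run_put3 (u := v) (c := true) r2) => // ar3 r3.
  apply: run_seq; apply: (run_copy_label_current (v := v) _ _ r3) => // va' ar4 fr r4.
  apply: (run_put2 (v := v) (u := v) (c := true) r4) => //=.
    by rewrite !fr //= h0 h3.
  move=> ar5 r5; do 2 eexists; split; first exact: r5.
  - by rewrite /fupd eqxx sv.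
  - by rewrite /fupd eqxx.
  - by move=> v' /negPf ne; rewrite /fupd ne.
apply: run_skip; do 2 eexists; split; first exact: r2.
- by rewrite /fupd eqxx (negPf sv).
- by rewrite (negPf sv).
- by move=> v' /negPf ne; rewrite /fupd ne.
Qed.

Definition selected S A rc v (P : {set U}) b (f : bool) : Prop :=
  if f then
    ((b = v /\ rc v) \/ (candidate M1 M2 S A rc v b /\
       (rc v -> (weight w (A b :\ v) < weight w (A v :\ v))%R))) /\
    forall u, u \in P -> candidate M1 M2 S A rc v u ->
      (weight w (A b :\ v) <= weight w (A u :\ v))%R
  else [/\ b = v, ~~ rc v & forall u, u \in P -> ~~ candidate M1 M2 S A rc v u].

Lemma selected_skip S A rc v P b f u : selected S A rc v P b f ->
  (candidate M1 M2 S A rc v u ->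
     f /\ (weight w (A b :\ v) <= weight w (A u :\ v))%R) ->
  selected S A rc v (u |: P) b f.
Proof.
rewrite /selected; case: f => [[h1 h2] h|[h1 h2 h3] h]; split=> //.
  by move=> x; rewrite !inE => /orP [/eqP->/h []|/h2].
move=> x; rewrite !inE => /orP [/eqP->|/h3 //].
by apply/negP => /h [].
Qed.

Lemma selected_update S A rc v P b (f : bool) u : selected S A rc v P b f ->
  candidate M1 M2 S A rc v u ->
  (f -> (weight w (A u :\ v) < weight w (A b :\ v))%R) ->
  selected S A rc v (u |: P) u true.
Proof.
rewrite /selected; case: f => [[h1 h2] cu /(_ isT) lt|[h1 h2 h3] cu _]; split.
- right; split=> // rv; case: h1 => [[e _]|[_ /(_ rv) lt2]].
    by rewrite e in lt.
  exact: lt_trans lt lt2.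
- move=> x; rewrite !inE => /orP [/eqP->//|xP cx].
  by apply/ltW/(lt_le_trans lt)/h2.
- by right; split=> //; rewrite (negPf h2).
- move=> x; rewrite !inE => /orP [/eqP->//|xP cx].
  by have := h3 x xP; rewrite cx.
Qed.

Lemma compare_weights_neq0 (T T' : {set U}) :
  (compare_weights w T T' != 0) = ~~ (weight w T < weight w T')%R.
Proof. by rewrite /compare_weights; case: ifP => // _; case: ifP. Qed.

(** All edits of the arrays are undone, so only the choice held in variables 5 and 6 can change. *)
Lemma run_relax_arc va ar B S A rc v u b (f : bool) P :
  va 0 = n -> va 3 = idx v -> va 4 = idx u -> va 5 = idx b -> va 6 = f ->
  va 11 = (v \in S) -> represents ar B S A rc ->
  (rc v -> common M1 M2 (A v :\ v)) -> selected S A rc v P b f ->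
  run RelaxArc (Store va ar) (fun s => represents (arrs s) B S A rc /\
    exists b' (f' : bool), [/\ vars s 5 = idx b', vars s 6 = f' &
      selected S A rc v (u |: P) b' f']).
Proof.
move=> h0 h3 h4 h5 h6 h11 r comv sel; rewrite /RelaxArc.
pose sv := v \in S; have notE : 1 - sv = ~~ sv by case: sv.
have skip va' ar' : represents ar' B S A rc -> va' 5 = idx b -> va' 6 = f ->
    ~~ candidate M1 M2 S A rc v u ->
    run Skip (Store va' ar') (fun s => represents (arrs s) B S A rc /\
    exists b' (f' : bool), [/\ vars s 5 = idx b', vars s 6 = f' &
      selected S A rc v (u |: P) b' f']).
  move=> r' h5' h6' nc; apply: run_skip; split=> //.
  by exists b, f; split=> //; apply: selected_skip sel _ => cu; rewrite cu in nc.
pose g := [&& (u \in S) != (v \in S), rc u & (v \in A u) == (v \in S)].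
apply: (run_ifN (b := g)) => [|ng|/and3P [nuv rcu /eqP vAu]].
- rewrite /= h0 h3 h4 h11 (rep1 r) (rep2 r) (rep3 r) /g.
  by case: (u \in S); case: (v \in S); case: (rc u); case: (v \in A u).
- by apply: skip => //; apply: contra ng; rewrite /g => /and5P [-> -> -> _ _].
have uS : (u \in S) = ~~ sv by move: nuv; rewrite /sv; case: (u \in S); case: (v \in S).
have uv : u != v by apply: contraNneq nuv => ->.
apply: run_seq; apply: (run_put1 (u := u) (c := sv) r) => // ar1 r1.
apply: run_seq; apply: (run_put1 (u := v) (c := ~~ sv) r1) => [//||ar2 r2].
  by rewrite /= h11.
set T := upd _ v (~~ sv) in r2.
apply: run_seq; apply: run_indep1; first exact: set_at1 r2.
apply: run_seq; apply: run_indep2; first exact: set_at1 r2.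
apply: run_seq; apply: (run_put1 (u := u) (c := ~~ sv) r2) => [//||ar3 r3].
  by rewrite /= h11.
apply: run_seq; apply: (run_put1 (u := v) (c := sv) r3) => // ar4 r4'.
have r4 : represents ar4 B S A rc.
  apply: (represents_ext r4') => // x; rewrite !in_upd.
  by case: eqP => [->//|_]; case: eqP => // ->.
have edgeE : edge M1 M2 S u v = if sv then M2 T else M1 T.
  rewrite /edge -/sv uS; case svE: (sv) => /=.
    congr (M2 _); apply/setP=> x; rewrite /T !in_upd svE !inE.
    have [->|xv] := eqVneq x v; first by rewrite eq_sym (negPf uv).
    by case: eqP.
  congr (M1 _); apply/setP=> x; rewrite /T !in_upd svE !inE.
  by have [->|xv] := eqVneq x v => //=; case: eqP.
apply: (run_ifN (b := edge M1 M2 S u v)) => [|ne|euv].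
- by rewrite /= h11 edgeE -/sv; case: (sv) => /=; rewrite ?mul1n ?mul0n ?addn0.
- by apply: skip => //; apply: contra ne => /and5P [].
(* Row u temporarily holds A u \ v for the tests; [rest] covers the final restoration. *)
pose A1 := fupd A u (A u :\ v).
apply: run_seq; apply: (run_put2 (v := u) (u := v) (c := false) r4) => [||ar5 r5].
- by rewrite /= h0 h3 h4.
- by [].
have A1u : A1 u = A u :\ v by rewrite /A1 /fupd eqxx.
have s5 va' : va' 0 = n -> va' 4 = idx u ->
    set_at U (Store va' ar5) 2 (eval (Store va' ar5) (Mul (Var 0) (Var 4))) =
    A u :\ v.
  by move=> /= -> ->; rewrite (set_at2 _ _ r5) -A1u.
apply: run_seq; apply: run_indep1; first exact: s5.
apply: run_seq; apply: run_indep2; first exact: s5.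
have rest va' ar' b' (f' : bool) : represents ar' B S A1 rc ->
    va' 0 = n -> va' 3 = idx v -> va' 4 = idx u -> va' 5 = idx b' ->
    va' 6 = f' -> va' 11 = sv -> selected S A rc v (u |: P) b' f' ->
    run (Put 2 (At 4 3) (Var 11)) (Store va' ar')
      (fun s => represents (arrs s) B S A rc /\
        exists b' (f' : bool), [/\ vars s 5 = idx b', vars s 6 = f' &
        selected S A rc v (u |: P) b' f']).
  move=> r' e0 e3 e4 e5 e6 e11 sel'.
  apply: (run_put2 (v := u) (u := v) (c := sv) r') => [||ar'' r''].
  - by rewrite /= e0 e3 e4.
  - by [].
  split=> /=; last by exists b', f'.
  apply: (represents_ext r'') => // x; rewrite /A1 /fupd.
  have [->|//] := eqVneq x u; apply/setP=> y; rewrite in_upd eqxx !inE.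
  by have [->|//] := eqVneq y v; rewrite vAu.
apply: run_seq.
have candE : common M1 M2 (A u :\ v) = candidate M1 M2 S A rc v u.
  by rewrite /candidate nuv rcu vAu eqxx euv.
apply: (run_ifN (b := candidate M1 M2 S A rc v u)) => [|nc|cu].
- by rewrite /= -candE /common mulnb.
- apply: run_skip; apply: (rest _ _ b f) => //.
  by apply: selected_skip sel _ => cu; rewrite cu in nc.
apply: (run_ifN (b := f)) => [//|nf|ft].
  apply: run_seq; apply: run_assign; first by rewrite /= h4 idx_lt_W.
  apply: run_assign; first by apply: small_lt_W.
  apply: (rest _ _ u true) => //; apply: selected_update sel cu _.
  by rewrite (negPf nf).
rewrite ft in sel h6.
have comb : common M1 M2 (A b :\ v).
  by case: (sel) => [] [[-> /comv //]|[/and5P [] //]].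
apply: run_seq; apply: run_assign.
  by rewrite /= h0 h3 h5 (rep2 r5) small_lt_W // leq_b1.
rewrite /= h0 h3 h5 (rep2 r5).
apply: run_seq; apply: (run_put2 (v := b) (u := v) (c := false) r5) => [||ar6 r6].
- by rewrite /= h0 h3 h5.
- by [].
apply: run_seq; apply: (run_compare W (T := A u :\ v) (T' := A b :\ v) _ _ _ _ _).
- rewrite /= h0 h4 (set_at2 _ _ r6) /fupd eqxx.
  (* The invariant does not exclude b = u, in which case both edits fall on the same row. *)
  have [->|//] := eqVneq u b; apply/setP=> x; rewrite !in_upd ?inE.
  by case: (x == v).
- rewrite /= h0 h5 (set_at2 _ _ r6) /fupd eqxx.
  have [->|//] := eqVneq b u; apply/setP=> x; rewrite !in_upd ?inE.
  by case: (x == v).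
- by rewrite candE.
- by [].
apply: run_seq.
(* Variable 12 was read after the edit of row u, so writing it back gives [A1] even if b = u. *)
apply: (run_put2 (v := b) (u := v) (c := v \in fupd A u (upd (A u) v false) b) r6)
  => [||ar7 r7'].
- by rewrite /= h0 h3 h5.
- by [].
have r7 : represents ar7 B S A1 rc.
  apply: (represents_ext r7') => // x; rewrite {1}/fupd; case: eqP => [->|ne].
    apply/setP=> y; rewrite in_upd; case: eqP => [->//|ny].
    by rewrite {1}/fupd eqxx in_upd; case: eqP.
  by rewrite {1}/fupd; case: eqP.
apply: (run_if_neq0 (b := ~~ (weight w (A u :\ v) < weight w (A b :\ v))%R)).
- by rewrite /= compare_weights_neq0.
- rewrite -leNgt => le; apply: run_skip; apply: (rest _ _ b true) => //.
  by apply: selected_skip sel _.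
rewrite negbK => lt; apply: run_assign; first by rewrite /= h4 idx_lt_W.
by apply: (rest _ _ u true) => //; apply: selected_update sel cu _.
Qed.

Lemma run_relax va ar B S A rc v : va 0 = n -> va 3 = idx v ->
  represents ar B S A rc ->
  (rc v -> common M1 M2 (A v :\ v) /\ (v \in A v) = (v \notin S)) ->
  run Relax (Store va ar) (fun s => exists A' rc',
    [/\ represents (arrs s) B S A' rc',
        relaxed M1 M2 w S A rc v (A' v) (rc' v) &
        forall v', v' != v -> A' v' = A v' /\ rc' v' = rc v']).
Proof.
move=> h0 h3 r lab; rewrite /Relax.
apply: run_seq; apply: run_assign; first by rewrite /= h3 (rep1 r) small_lt_W // leq_b1.
rewrite /= h3 (rep1 r).
apply: run_seq; apply: run_assign; first by rewrite /= h3 idx_lt_W.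
rewrite /= h3.
apply: run_seq; apply: run_assign; first by rewrite /= h3 (rep3 r) small_lt_W // leq_b1.
rewrite /= h3 (rep3 r).
apply: run_seq.
apply: (run_for n_lt_W (I := fun P s => represents (arrs s) B S A rc /\
    exists b (f : bool), [/\ vars s 5 = idx b, vars s 6 = f &
      selected S A rc v P b f])) => //.
- split=> //; exists v, (rc v); split=> //.
  rewrite /selected; case rv: (rc v); last by split=> // u; rewrite inE.
  by split=> [|u]; [left | rewrite inE].
- move=> P u va' ar' uP [/= r' [b [f [h5 h6 sel]]]] fr h4.
  apply: run_mono (run_relax_arc _ _ h4 h5 h6 _ r' _ sel) _ => //.
  + by rewrite fr.
  + by rewrite fr.
  + by rewrite fr.
  + by move=> /lab [].
move=> va' ar' [/= r' [b [f [h5 h6 sel]]]] fr.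
have e0 : va' 0 = n by rewrite fr.
have e3 : va' 3 = idx v by rewrite fr.
have e11 : va' 11 = (v \in S) by rewrite fr.
apply: (run_ifN (b := f)) => [//|nf|ft].
  rewrite (negPf nf) in sel; case: sel => [_ nrv nc].
  apply: run_skip; exists A, rc; split=> //; split; first by left.
  by move=> u cu; have := nc u (in_setT u); rewrite cu.
rewrite ft in sel; case: sel => [selb best].
apply: run_seq; apply: (run_put3 (u := v) (c := true) r') => // ar1 r1.
apply: run_seq; apply: (run_copy_label (v := v) (b := b) _ _ _ r1) => // va2 ar2 fr2 r2.
apply: (run_put2 (v := v) (u := v) (c := v \notin S) r2) => [||ar3 r3].
- by rewrite /= !fr2 // e0 e3.
- by rewrite /= fr2 // e11; case: (v \in S).
do 2 eexists; split; first exact: r3; last first.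
  by move=> v' /negPf ne; rewrite /fupd ne.
rewrite /fupd !eqxx.
have updD : upd (A b) v (v \notin S) :\ v = A b :\ v.
  by apply/setP=> z; rewrite in_setD1 in_upd !inE; case: eqP.
split; last by move=> u cu; rewrite updD; split=> //; apply: best.
case: selb => [[eb rv]|[cb lt]]; [left|right]; last by exists b.
split; last by rewrite rv.
rewrite eb; apply/setP=> z; rewrite in_upd; case: eqP => // ->.
by have [_ ->] := lab rv.
Qed.

(** * Correctness of the Bellman-Ford phases *)

Section Labels.
Variables (B S : {set U}) (reach : pred U) (D : U -> R) (H : U -> nat).
Hypothesis dist :
  distances (edge M1 M2 S) (source M1 S) (gain w S) reach D H.
Hypotheses (M1S : M1 S) (M2S : M2 S).

Notation label_inv := (label_inv M1 M2 w S reach D H).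

Definition labelled (t : nat) (s : store) : Prop :=
  exists A rc, represents (arrs s) B S A rc /\
    forall v, label_inv t v (A v) (rc v).

Lemma run_pass t (c : bool) va ar : va 0 = n -> odd t.+1 = c ->
  labelled t (Store va ar) -> run (Pass c) (Store va ar) (labelled t.+1).
Proof.
move=> h0 odt [A0 [rc0 [/= r0 lab0]]].
(* Visited vertices of side [c] are at phase t.+1, all others at t. Those of the other side are
   promoted at the end by parity. *)
pose tm (P : {set U}) v := if (v \in P) && ((v \in S) == c) then t.+1 else t.
apply: (run_for n_lt_W (I := fun P s => exists A rc,
    represents (arrs s) B S A rc /\
    forall v, label_inv (tm P v) v (A v) (rc v))) => //.
- by exists A0, rc0; split=> // v; rewrite /tm inE.
- move=> P v va' ar' vP [A [rc [/= r lab]]] fr h3.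
  have e0 : va' 0 = n by rewrite fr.
  have tm_other v' : v' != v -> tm (v |: P) v' = tm P v'.
    by rewrite /tm !inE => /negPf ->.
  have tm_v : tm P v = t by rewrite /tm (negPf vP).
  apply: (run_if (b := (v \in S) == c)) => [|/eqP vc|vc].
  + by rewrite /= h3 (rep1 r); case: (v \in S); case: (c).
  + have labv := lab v; rewrite tm_v in labv.
    have sndv : rc v -> common M1 M2 (A v :\ v) /\ (v \in A v) = (v \notin S).
      by case: labv => snd _ /snd [].
    apply: run_mono (run_relax e0 h3 r sndv) _ => s' [A' [rc' [r' rel oth]]].
    exists A', rc'; split=> // v'.
    have [->|ne] := eqVneq v' v.
      rewrite /tm setU11 vc eqxx /=; apply: (relaxed_label_inv dist M1S M2S _ labv rel) => //.
      move=> u nu; have := lab u; rewrite /tm -vc (negPf nu) andbF.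
      exact.
    by rewrite tm_other //; have [-> ->] := oth v' ne.
  apply: run_skip; exists A, rc; split=> // v'.
  have [->|ne] := eqVneq v' v; last by rewrite tm_other.
  by have := lab v; rewrite tm_v /tm (negPf vc) andbF.
move=> va' ar' [A [rc [r lab]]] _; exists A, rc; split=> // v.
have := lab v; rewrite /tm inE /=; case: eqP => // /eqP vc.
by apply: label_inv_next => //; rewrite odt eq_sym.
Qed.

Lemma run_init_labels va ar A rc : va 0 = n -> represents ar B S A rc ->
  run (For 3 InitLabel) (Store va ar) (labelled 0).
Proof.
move=> h0 r0.
apply: (run_for n_lt_W (I := fun P s => exists A rc,
    represents (arrs s) B S A rc /\
    forall v, v \in P -> rc v = source M1 S v /\
      (source M1 S v -> A v = v |: S))) => //.
- by exists A, rc; split=> // v; rewrite inE.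
- move=> P v va' ar' vP [A1 [rc1 [/= r lab]]] fr h3.
  have e0 : va' 0 = n by rewrite fr.
  apply: run_mono (run_init_label e0 h3 r) _ => s' [A' [rc' [r' rv Av oth]]].
  exists A', rc'; split=> // v'; rewrite !inE.
  have [->//|ne] := eqVneq v' v; move=> /= v'P.
  by have [-> ->] := oth v' ne; apply: lab.
move=> va' ar' [A1 [rc1 [r lab]]] _; exists A1, rc1; split=> // v.
have [-> Av] := lab v (in_setT v); exact: (init_label_inv dist M1S M2S).
Qed.

Lemma run_passes va ar : va 0 = n -> labelled 0 (Store va ar) ->
  run (For 2 (Seq (Pass 1) (Pass 0))) (Store va ar) (labelled n.*2).
Proof.
move=> h0 lab0.
apply: (run_for n_lt_W (I := fun P s => labelled #|P|.*2 s)) => //.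
- by rewrite cards0.
- move=> P v va' ar' vP lab fr _.
  have e0 : va' 0 = n by rewrite fr.
  apply: run_seq.
  have od : odd (#|P|.*2).+1 = true by rewrite /= odd_double.
  apply: run_mono (run_frame (run_pass e0 od lab)) _ => -[va2 ar2] [lab2 fr2].
  have e2 : va2 0 = n by have /= -> := fr2 0 isT.
  have od2 : odd (#|P|.*2).+2 = false by rewrite /= odd_double.
  apply: run_mono (run_pass e2 od2 lab2) _ => s' lab'.
  by rewrite cardsU1 vP add1n doubleS.
by move=> va' ar'; rewrite cardsT.
Qed.

End Labels.

(** * Choice of the next set and the main loop *)

Definition pickable S A rc v := [&& v \notin S, rc v & common M1 M2 (A v)].

Definition picked S A rc (P : {set U}) (s : store) : Prop :=
  exists f : bool, vars s 6 = f /\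
    if f then exists b, [/\ vars s 5 = idx b, pickable S A rc b &
      forall v, v \in P -> pickable S A rc v ->
        (weight w (A b) <= weight w (A v))%R]
    else forall v, v \in P -> ~~ pickable S A rc v.

Lemma picked_skip S A rc P v va ar : picked S A rc P (Store va ar) ->
  ~~ pickable S A rc v -> picked S A rc (v |: P) (Store va ar).
Proof.
move=> [f [h6 sel]] nv; exists f; split=> //; move: sel {h6}.
case: f => [[b [h5 pb best]]|no].
  exists b; split=> // v'; rewrite !inE => /orP [/eqP->|]; last exact: best.
  by rewrite (negPf nv).
by move=> v'; rewrite !inE => /orP [/eqP->|]; last exact: no.
Qed.

Lemma run_pick_label va ar B S A rc v P : va 0 = n -> va 3 = idx v ->
  represents ar B S A rc -> picked S A rc P (Store va ar) ->
  run PickLabel (Store va ar) (fun s => represents (arrs s) B S A rc /\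
    picked S A rc (v |: P) s).
Proof.
move=> h0 h3 r pk; rewrite /PickLabel.
apply: (run_ifN (b := (v \notin S) && rc v)) => [|ng|/andP [vS rv]].
- by rewrite /= h3 (rep1 r) (rep3 r); case: (v \in S); case: (rc v).
- apply: run_skip; split=> //; apply: picked_skip => //.
  by apply: contra ng => /and3P [-> ->].
have sv va' : va' 0 = n -> va' 3 = idx v ->
    set_at U (Store va' ar) 2 (eval (Store va' ar) (Mul (Var 0) (Var 3))) = A v.
  by move=> /= -> ->; rewrite (set_at2 _ _ r).
apply: run_seq; apply: run_indep1; first exact: sv.
apply: run_seq; apply: run_indep2; first exact: sv.
have comE : common M1 M2 (A v) = pickable S A rc v by rewrite /pickable vS rv.
apply: (run_ifN (b := pickable S A rc v)) => [|nv|pv].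
- by rewrite /= -comE /common mulnb.
- by apply: run_skip; split=> //; apply: (@picked_skip _ _ _ _ _ _ ar).
case: pk => f [/= h6 sel].
apply: (run_ifN (b := f)) => [//|nf|ft].
  apply: run_seq; apply: run_assign; first by rewrite /= h3 idx_lt_W.
  apply: run_assign; first by apply: small_lt_W.
  split=> //=; exists true; split=> //; exists v; split=> //= v'.
  rewrite (negPf nf) in sel; rewrite !inE => /orP [/eqP->//|v'P pv'].
  by have := sel v' v'P; rewrite pv'.
rewrite ft in sel h6; case: sel => b [/= h5 pb best].
have comb : common M1 M2 (A b) by case/and3P: pb.
apply: run_seq; apply: (run_compare W (T := A v) (T' := A b) _ _ _ _ _) => //.
- exact: sv.
- by rewrite /= h0 h5 (set_at2 _ _ r).
- by rewrite comE.
apply: (run_if_neq0 (b := ~~ (weight w (A v) < weight w (A b))%R)).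
- by rewrite /= compare_weights_neq0.
- rewrite -leNgt => le; apply: run_skip; split=> //=; exists true; split=> //.
  exists b; split=> //= v'; rewrite !inE => /orP [/eqP->//|]; exact: best.
rewrite negbK => lt; apply: run_assign; first by rewrite /= h3 idx_lt_W.
split=> //=; exists true; split=> //; exists v; split=> //= v'.
rewrite !inE => /orP [/eqP->//|v'P pv'].
by apply: le_trans (ltW lt) _; apply: best.
Qed.

Lemma run_pick va ar B S A rc : va 0 = n -> represents ar B S A rc ->
  va 6 = 0 ->
  run (For 3 PickLabel) (Store va ar) (fun s => [/\ vars s 0 = n,
    represents (arrs s) B S A rc & picked S A rc setT s]).
Proof.
move=> h0 r h6.
apply: (run_for n_lt_W (I := fun P s => represents (arrs s) B S A rc /\
  picked S A rc P s)) => //.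
- by split=> //; exists false; split=> // v; rewrite inE.
- move=> P v va' ar' vP [/= r' pk] fr h3.
  have e0 : va' 0 = n by rewrite fr.
  by apply: run_mono (run_pick_label e0 h3 r' pk) _.
by move=> va' ar' [r' pk] fr; split=> //=; rewrite fr.
Qed.

(** S is optimal only for its own size, whereas the optimum may occur at any size; B accounts for
    all sizes up to |S|. *)
Definition best_and_current (B S : {set U}) : Prop :=
  [/\ common M1 M2 B, split_optimal M1 M2 w S,
      (weight w B <= weight w S)%R &
      forall T, common M1 M2 T -> #|T| <= #|S| ->
        (weight w B <= weight w T)%R].

Definition maximum S := forall T, common M1 M2 T -> #|T| <= #|S|.

Lemma run_update va ar B S A rc b : va 0 = n -> represents ar B S A rc ->
  va 6 = 1 -> va 5 = idx b -> split_optimal M1 M2 w (A b) ->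
  #|A b| = #|S|.+1 -> best_and_current B S ->
  run Update (Store va ar) (fun s => exists B',
    represents (arrs s) B' (A b) A rc /\ best_and_current B' (A b)).
Proof.
move=> h0 r h6 h5 optA cA [comB optS leBS minB]; rewrite /Update.
apply: (run_if (b := true)) => [//|_|//].
have comA : common M1 M2 (A b).
  by case: (optA) => w1 [w2 [_ [m1 _] [m2 _]]]; rewrite /common m1 m2.
apply: run_seq; apply: (run_copy_current (b := b) _ _ r) => // va1 ar1 fr1 r1.
apply: run_seq; apply: (run_compare W (T := A b) (T' := B) _ _ _ _ _) => //.
- exact: set_at1 r1.
- exact: set_at0 r1.
have minT T X : common M1 M2 T -> #|T| <= #|A b| ->
    (weight w X <= weight w B)%R -> (weight w X <= weight w (A b))%R ->
    (weight w X <= weight w T)%R.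
  move=> cT; rewrite cA leq_eqVlt ltnS => /orP [/eqP eT|leT] leXB leXA.
    by apply: le_trans leXA _; apply: split_optimal_min optA cT _; rewrite cA.
  exact: le_trans leXB (minB T cT leT).
apply: (run_if_neq0 (b := ~~ (weight w (A b) < weight w B)%R)).
- by rewrite /= compare_weights_neq0.
- rewrite -leNgt => le; apply: run_skip; exists B; split=> //.
  by split=> // T cT leT; apply: minT.
rewrite negbK => lt; apply: (run_copy_best _ r1) => [|va2 ar2 fr2 r2].
  by rewrite /= fr1.
exists (A b); split=> //; split=> // T cT leT.
by apply: minT => //; apply: ltW.
Qed.

Lemma run_augment va ar B S A rc : va 0 = n -> represents ar B S A rc ->
  best_and_current B S ->
  run Augment (Store va ar) (fun s => exists B' S' A' rc',
    [/\ represents (arrs s) B' S' A' rc', best_and_current B' S' &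
        #|S'| = #|S|.+1 \/ #|S'| = #|S| /\ maximum S']).
Proof.
move=> h0 r bc; have [comB optS leBS minB] := bc.
have [w1 [w2 [sp min1 min2]]] := optS.
have [M1S M2S] : M1 S /\ M2 S by case: min1 min2 => [? _] [].
have [reach [D [H dist]]] :=
  distances_exist (source M1 S) (split_potential sp min1 min2).
apply: run_seq; apply: run_mono (run_frame (run_init_labels dist M1S M2S h0 r)) _.
move=> [va1 ar1] [lab1 fr1]; have e1 : va1 0 = n by have /= -> := fr1 0 isT.
apply: run_seq; apply: run_mono (run_frame (run_passes dist M1S M2S e1 lab1)) _.
move=> [va2 ar2] [[A2 [rc2 [/= r2 lab2]]] fr2].
have e2 : va2 0 = n by have /= -> := fr2 0 isT.
apply: run_seq; apply: run_assign; first by apply: small_lt_W.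
apply: run_seq; apply: run_mono (run_pick _ r2 _) _ => //.
move=> [va3 ar3] [/= e3 r3 [f [/= h6 sel]]].
have leU : n <= (n.*2).+1 by rewrite -addnn; move: n => m; lia.
have sinkE := sink_label dist M1S M2S lab2 leU.
have pick v : reach v -> sink M2 S v -> rc2 v -> common M1 M2 (A2 v) ->
    pickable S A2 rc2 v.
  by move=> _ /andP [vS _] rv cv; apply/and3P.
case: f h6 sel => h6 sel; last first.
  (* Nothing was picked, but a reachable sink would have produced a pickable label. *)
  have max : maximum S.
    apply: (no_augmenting_path dist M1S M2S) => v rv; apply/negP => sv.
    have [|v' [rv' sv' _ rcv' [cv' _]]] := sinkE; first by exists v.
    by have := sel v' (in_setT _); rewrite (pick v').
  rewrite /Update; apply: (run_if (b := false)) => //= _.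
  by apply: run_skip; exists B, S, A2, rc2; split=> //; right.
have [b [h5 pb best]] := sel; have [bS rb comb] := and3P pb.
have cb : #|A2 b| = #|S|.+1.
  by have [/(_ rb) [_ -> _ _ _] _] := lab2 b; rewrite bS addn1.
(* The picked b need not be a sink. As its label is a common independent set larger than S, some
   sink is reachable, and the label is no heavier than that of a nearest sink. *)
have optb : split_optimal M1 M2 w (A2 b).
  have sk : exists2 v, reach v & sink M2 S v.
    apply: contrapT => no.
    have nosink v : reach v -> ~~ sink M2 S v.
      by move=> rv; apply/negP => sv; apply: no; exists v.
    have := no_augmenting_path dist M1S M2S nosink comb.
    by rewrite cb ltnn.
  have [v [rv sv minv rcv [cv wv]]] := sinkE sk.
  apply: (augment_split_optimal optS dist minv comb cb).
  by rewrite -wv; apply: best (in_setT _) (pick v rv sv rcv cv).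
apply: run_mono (run_update e3 r3 h6 h5 optb cb bc) _ => s [B' [r' bc']].
by exists B', (A2 b), A2, rc2; split=> //; left.
Qed.

Lemma run_matroid_intersection :
  run matroid_intersection (init n) (fun s =>
    min_weight_common M1 M2 w (output U s)).
Proof.
(* After #|P| rounds S has #|P| elements or is maximum, so after n rounds B beats every common
   independent set. *)
apply: (run_for n_lt_W (I := fun P s => exists B S A rc,
  [/\ represents (arrs s) B S A rc, best_and_current B S &
      #|S| = #|P| \/ maximum S])) => //.
- exists set0, set0, (fun=> set0), (fun=> false); split; last by left.
    by split=> * /=; rewrite ?inE.
  have com0 : common M1 M2 set0 by rewrite /common !indep_set0.
  split=> //; first exact: split_optimal_set0.
  by move=> T _; rewrite cards0 leqn0 => /eqP /cards0_eq ->.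
- move=> P u va ar uP [B [S [A [rc [/= r bc cS]]]]] fr _.
  have e0 : va 0 = n by rewrite fr.
  apply: run_mono (run_augment e0 r bc) _ => s.
  move=> [B' [S' [A' [rc' [r' bc' cS']]]]]; exists B', S', A', rc'; split=> //.
  rewrite cardsU1 uP add1n; case: cS' => [cS'|[_ max]]; last by right.
  case: cS => [<-|max]; first by left.
  have [_ [w1 [w2 [_ [m1 _] [m2 _]]]] _ _] := bc'.
  by have := max S'; rewrite /common m1 m2 cS' ltnn => /(_ isT).
move=> va ar [B [S [A [rc [/= r [comB _ _ minB] cS]]]]] _.
rewrite /output (set_at0 _ r); split=> // T cT; apply: minB => //.
by case: cS => [->|]; [rewrite cardsT max_card | apply].
Qed.

End Program.

Theorem mainTheorem9 :
  exists (p : cmd) (k c n0 : nat),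
    forall (R : realType) (U : finType) (M1 M2 : matroid U) (w : U -> R),
    exists (queries time : nat) (s : store),
      [/\ exec M1 M2 w (word_bound k #|U|) p (init #|U|) queries time s,
          min_weight_common M1 M2 w (output U s)
        & n0 <= #|U| -> queries <= c * #|U| ^ 4 /\ time <= c * #|U| ^ 4].
Proof.
(* Addresses stay below n * n, hence k = 2; n0 = 1 because [time_bound_poly] bounds the n.+1 tests
   of a loop by 2 * n. *)
exists matroid_intersection, 2, (time_coef matroid_intersection), 1.
move=> R U M1 M2 w.
have hW : #|U| * #|U| + #|U| + 2 < word_bound 2 #|U|.
  rewrite /word_bound expnS expn1 mulnDl !mulnDr.
  by move: (#|U| * #|U|) #|U| => m k; lia.
have [q [t [s [ex let_ opt]]]] := run_matroid_intersection M1 M2 w hW.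
exists q, t, s; split=> // n0.
(* [loop_depth] computes to 4: augmentations, rounds of two phases, heads and tails of arcs. *)
have let4 := leq_trans let_ (time_bound_poly matroid_intersection n0).
by split=> //; apply: leq_trans let4; apply: exec_queries_le ex.
Qed.
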